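(* Let $\nu>0$ be real with $\nu\notin\mathbb{Z}$, and let $z\in\mathbb{C}$, $z\neq 0$, $|\arg z|<\pi$. Then $$\begin{aligned}\frac{\partial K_\nu(z)}{\partial\nu}={}&\frac\pi2\csc(\pi\nu)\Biggl\{\pi\cot(\pi\nu)\,I_\nu(z)-\bigl[I_\nu(z)+I_{-\nu}(z)\bigr]\left[\frac{z^2}{4(1-\nu^2)}\,{}_3F_4\left(\left.\begin{array}{c}1,\ 1,\ \frac32\\ 2,\ 2,\ 2-\nu,\ 2+\nu\end{array}\right|z^2\right)+\log\left(\frac z2\right)-\psi(\nu)-\frac1{2\nu}\right]\Biggr\}\\&+\frac14\Biggl\{I_{-\nu}(z)\,\Gamma^2(-\nu)\left(\frac z2\right)^{2\nu}{}_2F_3\left(\left.\begin{array}{c}\nu,\ \frac12+\nu\\ 1+\nu,\ 1+\nu,\ 1+2\nu\end{array}\right|z^2\right)\\&\qquad-I_\nu(z)\,\Gamma^2(\nu)\left(\frac z2\right)^{-2\nu}{}_2F_3\left(\left.\begin{array}{c}-\nu,\ \frac12-\nu\\ 1-\nu,\ 1-\nu,\ 1-2\nu\end{array}\right|z^2\right)\Biggr\}.\end{aligned}$$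
   Context: Powers and logarithms take their principal values. $I_\nu(z)=(z/2)^\nu\sum_{k\ge0}\frac{(z/2)^{2k}}{k!\,\Gamma(\nu+k+1)}$ is the modified Bessel function and, for $\nu\notin\mathbb{Z}$, $K_\nu(z)=\frac\pi2\frac{I_{-\nu}(z)-I_\nu(z)}{\sin\pi\nu}$ is the Macdonald function; $\partial/\partial\nu$ is the derivative with respect to the order at fixed $z$. $\Gamma$ is the gamma function and $\psi=\Gamma'/\Gamma$ is the digamma function. The generalized hypergeometric function is ${}_pF_q\left(\left.\begin{array}{c}a_1,\dots,a_p\\ b_1,\dots,b_q\end{array}\right|x\right)=\sum_{k\ge0}\frac{(a_1)_k\cdots(a_p)_k}{(b_1)_k\cdots(b_q)_k}\frac{x^k}{k!}$ with $(\alpha)_k=\Gamma(\alpha+k)/\Gamma(\alpha)$.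
   Formalization: When ν is a half-integer, the last ₂F₃ (parameters 1/2−ν and 1−2ν both nonpositive integers) has undefined 0/0 terms; there it is taken to be its limit as the order tends to ν. For all other ν the formula is literal. *)

(* Defs.v *)
From Stdlib Require Import Reals Factorial List.
From Coquelicot Require Import Coquelicot.
Open Scope R_scope.

(* Euler's limit; it converges to Gamma x for every real x that is not one of
   the poles 0, -1, -2, ..., so negative non-integer arguments are covered. *)
Definition Gamma (x : R) : R :=
  real (Lim_seq (fun n : nat =>
    INR (fact n) * Rpower (INR n) x / prod_f_R0 (fun j => x + INR j) n)).

Definition digamma (x : R) : R := Derive Gamma x / Gamma x.

Definition csc (x : R) : R := / sin x.
Definition cot (x : R) : R := cos x / sin x.

Definition Cexp (z : C) : C := (exp (Re z) * cos (Im z), exp (Re z) * sin (Im z)).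

(* Principal argument, with values in (-PI, PI]; used only for z <> 0. *)
Definition Carg (z : C) : R :=
  if Rle_dec 0 (Im z) then acos (Re z / Cmod z) else - acos (Re z / Cmod z).

Definition Clog (z : C) : C := (ln (Cmod z), Carg z).

(* Principal value of z to a real exponent; z ^ n is the natural power. *)
Definition Crpower (z : C) (a : R) : C := Cexp (a * Clog z)%C.

(* The value is meaningful when both real series converge. *)
Definition CSeries (a : nat -> C) : C :=
  (Series (fun k => Re (a k)), Series (fun k => Im (a k))).

(* Meaningful when neither a nor a + k is a pole of Gamma. *)
Definition pochhammer (a : R) (k : nat) : R := Gamma (a + INR k) / Gamma a.

Definition pochhammers (l : list R) (k : nat) : R :=
  fold_right (fun a p => pochhammer a k * p) 1 l.

Definition pFq (a b : list R) (x : C) : C :=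
  CSeries (fun k =>
    RtoC (pochhammers a k / pochhammers b k) * (x ^ k / RtoC (INR (fact k))))%C.

Definition BesselI (nu : R) (z : C) : C :=
  (Crpower (z / 2) nu *
   CSeries (fun k => (z / 2) ^ (2 * k)
                     / RtoC (INR (fact k) * Gamma (nu + INR k + 1))))%C.

(* Meaningful for non-integer nu. *)
Definition BesselK (nu : R) (z : C) : C :=
  (PI / 2 * ((BesselI (- nu) z - BesselI nu z) / RtoC (sin (PI * nu))))%C.

Definition F34 (nu : R) (z : C) : C :=
  pFq (1 :: 1 :: 3 / 2 :: nil) (2 :: 2 :: 2 - nu :: 2 + nu :: nil) (z ^ 2)%C.

Definition F23 (nu : R) (z : C) : C :=
  pFq (nu :: 1 / 2 + nu :: nil) (1 + nu :: 1 + nu :: 1 + 2 * nu :: nil) (z ^ 2)%C.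

(* [is_F23_neg nu z F]: F is the value at -nu of the function F23.  If nu is a
   positive half-integer, then 1/2 - nu and 1 - 2 nu are both nonpositive
   integers and the terms of the series read 0/0 from some index on; this
   singularity in nu is removable, and F is then the limit in the order. *)
Definition is_F23_neg (nu : R) (z F : C) : Prop :=
  ((forall m : nat, nu <> INR m + 1 / 2) -> F = F23 (- nu) z) /\
  ((exists m : nat, nu = INR m + 1 / 2) ->
     filterlim (fun mu : R => F23 (- mu) z) (locally' nu)
               (locally (T := C_UniformSpace) F)).

(* Main.v *)
Require Import Defs.
From Stdlib Require Import Reals List.
From Coquelicot Require Import Coquelicot.
From Stdlib Require Import ZArith Factorial Lra Lia FunctionalExtensionality.
Open Scope R_scope.

(** With t = (z/2)^2 write I_mu(z) = (z/2)^mu / Gamma(mu+1) * u(t), where u has the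
    coefficients 1/(k! (mu+1)_k), and let v be the same series at -mu.  The heart of the
    matter is the identity
      2 mu du/dmu = u (2 mu G + 1) - v F
    between power series in t, where G = z^2/(4(1-mu^2)) 3F4 and F = 2F3 at mu.  With
    D = t d/dt, both sides solve D(D + mu) w + 2 mu D u = t w with w(0) = 0: the product
    formulas for u v and u^2 (Vandermonde) say that 2 D G = u v - 1 and (D + mu) F = mu u^2,
    and the Wronskian v Du - u Dv + mu u v equals mu.  The theorem follows by using the
    resulting formula for dI_mu/dmu at nu and at -nu, together with the reflection formulas
    of Gamma and digamma.

    Gamma is differentiated through the logarithm of its product, and Gamma reflection is
    Euler's sine product, obtained from the integrals of cos^n t cos(2xt) over [0, pi/2]. *)

(** * Formal power series *)

(** Differentiating the Bessel series in the order directly gives a digamma value in every term; the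
    differential equations avoid these sums. In t the argument is formal: D multiplies the n-th
    coefficient by n, so no function of t is ever differentiated. Analysis enters only in mu,
    through coefficient bounds that survive Cauchy products. The obstacle is a half-integer nu,
    where the written 2F3 at -nu has coefficients 0/0. [Fc] is therefore defined from a product of
    series, which is regular at every non-integer order. One expression then serves in all cases,
    and only its identification with [F23] distinguishes them, by continuity in the order. The
    asymmetric term pi cot(pi nu) I_nu arises as follows. G is even in mu, and by digamma reflection
    the bracket G + log(z/2) - psi(mu) - 1/(2 mu) at mu = -nu is the one at nu minus pi cot(pi nu).
    The resulting multiple of I_{-nu} cancels against the one produced by the derivative of 1/sin(pi
    nu), and that derivative leaves the multiple of I_nu. *)

Notation fps := (nat -> R).

(* Cauchy product; recursion on the head of [a] makes associativity a two-line induction. *)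
Fixpoint conv (a b : fps) (n : nat) : R :=
  match n with
  | O => a O * b O
  | S m => a O * b (S m) + conv (fun k => a (S k)) b m
  end.

Definition fps_add (a b : fps) : fps := fun n => a n + b n.
Definition fps_opp (a : fps) : fps := fun n => - a n.
Definition fps_sub (a b : fps) : fps := fun n => a n - b n.
Definition fps_const (c : R) : fps := fun n => match n with O => c | _ => 0 end.
Definition fps_X : fps := fun n => match n with 1%nat => 1 | _ => 0 end.
Definition euler (a : fps) : fps := fun n => INR n * a n.

Lemma conv_add_l a b c n : conv (fps_add a b) c n = conv a c n + conv b c n.
Proof.
  revert a b; induction n as [|n IH]; intros a b; simpl; unfold fps_add at 1; [ring|].
  change (fun k : nat => fps_add a b (S k))
    with (fps_add (fun k => a (S k)) (fun k => b (S k))).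
  rewrite IH; ring.
Qed.

Lemma conv_scal_l x a b n : conv (fun k => x * a k) b n = x * conv a b n.
Proof.
  revert a; induction n as [|n IH]; intros a; simpl; [ring|].
  rewrite (IH (fun k => a (S k))); ring.
Qed.

Lemma conv_0_l a n : conv (fun _ => 0) a n = 0.
Proof. induction n as [|n IH]; simpl; [ring|rewrite IH; ring]. Qed.

Lemma conv_Sr a b n : conv a b (S n) = a (S n) * b O + conv a (fun k => b (S k)) n.
Proof.
  revert a; induction n as [|n IH]; intros a; [simpl; ring|].
  change (conv a b (S (S n))) with (a O * b (S (S n)) + conv (fun k => a (S k)) b (S n)).
  rewrite IH; simpl; ring.
Qed.

Lemma conv_comm a b n : conv a b n = conv b a n.
Proof.
  revert a b; induction n as [|n IH]; intros a b; [simpl; ring|].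
  rewrite conv_Sr; simpl; rewrite IH; ring.
Qed.

Lemma conv_assoc a b c n : conv a (conv b c) n = conv (conv a b) c n.
Proof.
  revert a; induction n as [|n IH]; intros a; [simpl; ring|].
  change (conv (conv a b) c (S n))
    with (a O * b O * c (S n)
          + conv (fps_add (fun k => a O * b (S k)) (conv (fun k => a (S k)) b)) c n).
  rewrite conv_add_l, (conv_scal_l (a O) (fun k => b (S k))), <- IH.
  simpl; ring.
Qed.

Lemma conv_const_l x a n : conv (fps_const x) a n = x * a n.
Proof.
  destruct n; simpl; [reflexivity|].
  change (fun k : nat => 0) with (fun _ : nat => 0). rewrite conv_0_l; ring.
Qed.

Lemma conv_X_S a n : conv fps_X a (S n) = a n.
Proof.
  simpl. rewrite Rmult_0_l, Rplus_0_l.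
  replace (fun k : nat => match k with O => 1 | S _ => 0 end) with (fps_const 1)
    by (apply functional_extensionality; intros [|k]; reflexivity).
  rewrite conv_const_l; ring.
Qed.

(** This turns the manipulations of differential equations below into goals for [ring], with a
    series and its images under [euler] as atoms. *)
Lemma fps_ring_theory :
  ring_theory (fps_const 0) (fps_const 1) fps_add conv fps_sub fps_opp (@eq fps).
Proof.
  constructor; intros; apply functional_extensionality; intro n;
    unfold fps_sub, fps_add, fps_opp; try ring.
  - destruct n; simpl; ring.
  - rewrite conv_const_l; ring.
  - apply conv_comm.
  - apply conv_assoc.
  - apply conv_add_l.
  - destruct n; simpl; ring.
Qed.

Add Ring fps_ring : fps_ring_theory.

Declare Scope fps_scope.
Delimit Scope fps_scope with fps.
Infix "+" := fps_add : fps_scope.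
Infix "-" := fps_sub : fps_scope.
Infix "*" := conv : fps_scope.

Lemma fps_const_add x y : fps_const (x + y) = (fps_const x + fps_const y)%fps.
Proof. apply functional_extensionality; intros [|n]; unfold fps_add; simpl; ring. Qed.
Lemma fps_const_mul x y : fps_const (x * y) = (fps_const x * fps_const y)%fps.
Proof.
  apply functional_extensionality; intro n; rewrite conv_const_l.
  destruct n; simpl; ring.
Qed.

Lemma euler_add a b : euler (a + b)%fps = (euler a + euler b)%fps.
Proof. apply functional_extensionality; intro n; unfold euler, fps_add; ring. Qed.
Lemma euler_sub a b : euler (a - b)%fps = (euler a - euler b)%fps.
Proof. apply functional_extensionality; intro n; unfold euler, fps_sub; ring. Qed.
Lemma euler_const x : euler (fps_const x) = fps_const 0.
Proof. apply functional_extensionality; intros [|n]; unfold euler; simpl; ring. Qed.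

Lemma euler_mul a b : euler (a * b)%fps = (euler a * b + a * euler b)%fps.
Proof.
  apply functional_extensionality; intro n; unfold euler at 1, fps_add.
  revert a; induction n as [|n IH]; intros a; [unfold euler; simpl; ring|].
  simpl conv.
  (* Dropping the head of [a] commutes with [euler] only up to an extra copy of the shifted series,
     because index k becomes k + 1. *)
  replace (fun k : nat => euler a (S k))
    with (fps_add (euler (fun k => a (S k))) (fun k => a (S k)))
    by (apply functional_extensionality; intro k; unfold euler, fps_add;
        rewrite S_INR; ring).
  rewrite conv_add_l.
  specialize (IH (fun k => a (S k))).
  replace (euler a O) with 0 by (unfold euler; simpl; ring).
  replace (euler b (S n)) with (INR (S n) * b (S n)) by reflexivity.
  replace (conv (euler (fun k => a (S k))) b n)
    with (INR n * conv (fun k => a (S k)) b n - conv (fun k => a (S k)) (euler b) n)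
    by (rewrite IH; ring).
  rewrite S_INR; ring.
Qed.

(** * Bessel coefficients and their differential equations *)

Definition noninteger (x : R) := forall n : Z, x <> IZR n.

Lemma noninteger_opp x : noninteger x -> noninteger (- x).
Proof. intros H n E; apply (H (- n)%Z); rewrite opp_IZR; lra. Qed.

Lemma noninteger_plus_INR x n : noninteger x -> noninteger (x + INR n).
Proof. intros H m E; apply (H (m - Z.of_nat n)%Z); rewrite minus_IZR, <- INR_IZR_INZ; lra. Qed.

Lemma noninteger_neq0 x : noninteger x -> x <> 0.
Proof. intros H; exact (H 0%Z). Qed.

Lemma noninteger_plus_INR_neq0 x n : noninteger x -> x + INR n <> 0.
Proof. intros H; apply noninteger_neq0, noninteger_plus_INR, H. Qed.

(** D(D + mu) multiplies the n-th coefficient by n(n + mu), which is nonzero for n >= 1, so each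
    coefficient is forced by the previous one. At n = 0 the factor vanishes, and the constant term
    has to be given. *)
Lemma euler_ode_unique mu e : noninteger mu -> e O = 0 ->
  euler (euler e + fps_const mu * e)%fps = (fps_X * e)%fps -> forall n, e n = 0.
Proof.
  intros Hmu H0 H n; induction n as [|n IH]; [exact H0|].
  apply (f_equal (fun f => f (S n))) in H.
  rewrite conv_X_S, IH in H. unfold euler, fps_add in H. rewrite conv_const_l in H.
  assert (INR (S n) <> 0) by (apply not_0_INR; lia).
  pose proof (noninteger_plus_INR_neq0 mu (S n) Hmu) as Hne.
  replace (INR (S n) * (INR (S n) * e (S n) + mu * e (S n)))
    with (e (S n) * (INR (S n) * (mu + INR (S n)))) in H by ring.
  apply Rmult_integral in H; destruct H as [H|H]; [exact H|].
  apply Rmult_integral in H; tauto.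
Qed.

Fixpoint rf (a : R) (k : nat) : R :=
  match k with O => 1 | S m => rf a m * (a + INR m) end.

(* The series u; [dbc] is its derivative in mu, see [bc_dbc_bounds]. *)
Definition bc (mu : R) (k : nat) : R := / (INR (fact k) * rf (mu + 1) k).

Fixpoint dbc (mu : R) (k : nat) : R :=
  match k with
  | O => 0
  | S m => (dbc mu m / (mu + INR (S m)) - bc mu m / (mu + INR (S m)) ^ 2) / INR (S m)
  end.

Lemma rf_neq0 a k : (forall j, (j < k)%nat -> a + INR j <> 0) -> rf a k <> 0.
Proof.
  induction k as [|k IH]; intros H; simpl; [lra|].
  apply Rmult_integral_contrapositive_currified; [apply IH; intros; apply H; lia|apply H; lia].
Qed.

Lemma rf_noninteger_neq0 a k : noninteger a -> rf a k <> 0.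
Proof. intros H; apply rf_neq0; intros; apply noninteger_plus_INR_neq0, H. Qed.

Lemma noninteger_plus1 x : noninteger x -> noninteger (x + 1).
Proof. exact (noninteger_plus_INR x 1). Qed.

Lemma bc_S mu k : noninteger mu ->
  bc mu (S k) = bc mu k / (mu + INR (S k)) / INR (S k).
Proof.
  intros H; unfold bc. simpl rf.
  rewrite fact_simpl, mult_INR.
  pose proof (rf_noninteger_neq0 _ k (noninteger_plus1 _ H)).
  pose proof (noninteger_plus_INR_neq0 mu (S k) H).
  assert (INR (S k) <> 0) by (apply not_0_INR; lia).
  replace (mu + 1 + INR k) with (mu + INR (S k)) by (rewrite S_INR; ring).
  pose proof (INR_fact_neq_0 k).
  field; tauto.
Qed.

Lemma bc_0 mu : bc mu 0 = 1.
Proof. unfold bc; simpl; field. Qed.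

Lemma bc_ode mu : noninteger mu ->
  euler (euler (bc mu) + fps_const mu * bc mu)%fps = (fps_X * bc mu)%fps.
Proof.
  intros H; apply functional_extensionality; intros [|n].
  - unfold euler; simpl; ring.
  - rewrite conv_X_S; unfold euler, fps_add; rewrite conv_const_l, bc_S by exact H.
    assert (INR (S n) <> 0) by (apply not_0_INR; lia).
    pose proof (noninteger_plus_INR_neq0 mu (S n) H).
    field; tauto.
Qed.

(** This is [bc_ode] differentiated in mu; the extra D u comes from the explicit mu in the
    operator. *)
Lemma dbc_ode mu : noninteger mu ->
  (euler (euler (dbc mu) + fps_const mu * dbc mu) + euler (bc mu))%fps
  = (fps_X * dbc mu)%fps.
Proof.
  intros H; apply functional_extensionality; intros [|n].
  - unfold euler, fps_add; simpl; ring.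
  - rewrite conv_X_S; unfold euler, fps_add; rewrite conv_const_l, bc_S by exact H.
    simpl dbc.
    assert (INR (S n) <> 0) by (apply not_0_INR; lia).
    pose proof (noninteger_plus_INR_neq0 mu (S n) H).
    change (match n with O => 1 | S _ => INR n + 1 end) with (INR (S n)).
    field; tauto.
Qed.

(* The series G and F.  In this form the coefficients of F have no 0/0 at
   half-integers mu, see [Fc_eq]. *)
Definition Gc (mu : R) (k : nat) : R :=
  match k with O => 0 | _ => conv (bc mu) (bc (- mu)) k / (2 * INR k) end.
Definition Fc (mu : R) (k : nat) : R := mu / (mu + INR k) * conv (bc mu) (bc mu) k.

Lemma euler_Gc mu : (fps_const 2 * euler (Gc mu))%fps = (bc mu * bc (- mu) - fps_const 1)%fps.
Proof.
  apply functional_extensionality; intros [|n].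
  - unfold euler, fps_sub; simpl; rewrite !bc_0; ring.
  - rewrite conv_const_l; unfold euler, fps_sub, Gc, fps_const.
    assert (INR (S n) <> 0) by (apply not_0_INR; lia).
    field; tauto.
Qed.

Lemma euler_Fc mu : noninteger mu ->
  (euler (Fc mu) + fps_const mu * Fc mu)%fps = (fps_const mu * (bc mu * bc mu))%fps.
Proof.
  intros H; apply functional_extensionality; intros n.
  unfold fps_add, euler; rewrite !conv_const_l; unfold Fc.
  pose proof (noninteger_plus_INR_neq0 mu n H).
  field; tauto.
Qed.

(** The left side is the Wronskian, with respect to D, of t^(mu/2) u and t^(-mu/2) v, which up to
    constants are I_mu and I_{-mu}; the prefactors contribute the term mu u v. D annihilates it by
    the two equations, so only its constant term mu is left. *)
Lemma wronskian mu : noninteger mu ->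
  (bc (- mu) * euler (bc mu) - bc mu * euler (bc (- mu))
   + fps_const mu * (bc mu * bc (- mu)))%fps = fps_const mu.
Proof.
  intros H.
  set (u := bc mu); set (v := bc (- mu)).
  assert (Hu : euler (euler u) = (fps_X * u - fps_const mu * euler u)%fps).
  { pose proof (bc_ode mu H) as H0; fold u in H0.
    rewrite <- H0, euler_add, euler_mul, euler_const; ring. }
  assert (Hv : euler (euler v) = (fps_X * v + fps_const mu * euler v)%fps).
  { pose proof (bc_ode (- mu) (noninteger_opp _ H)) as H0; fold v in H0.
    rewrite <- H0, euler_add, euler_mul, euler_const.
    replace (fps_const (- mu)) with (fps_opp (fps_const mu))
      by (apply functional_extensionality; intros [|k]; unfold fps_opp; simpl; ring).
    ring. }
  set (w := (v * euler u - u * euler v + fps_const mu * (u * v))%fps).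
  assert (Hw : euler w = fps_const 0).
  { unfold w; rewrite euler_add, euler_sub, !euler_mul, euler_const, Hu, Hv; ring. }
  apply functional_extensionality; intros [|n].
  - unfold w, fps_add, fps_sub; simpl; unfold euler; simpl; unfold u, v.
    rewrite !bc_0; ring.
  - apply (f_equal (fun f => f (S n))) in Hw; unfold euler in Hw; simpl fps_const in *.
    apply Rmult_integral in Hw; destruct Hw as [Hw|Hw]; [|exact Hw].
    exfalso; revert Hw; apply not_0_INR; lia.
Qed.

(** The functions u and t^(-mu) v solve the homogeneous equation D(D + mu) w = t w, and the right
    side combines them with the variable coefficients 2 mu G + 1 and -t^mu F, much as in variation
    of constants; (D + mu) F = mu u^2 says that D(t^mu F) = mu t^mu u^2. *)
Lemma dbc_eq mu : noninteger mu ->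
  (fps_const (2 * mu) * dbc mu)%fps
  = (bc mu * (fps_const (2 * mu) * Gc mu + fps_const 1) - bc (- mu) * Fc mu)%fps.
Proof.
  intros H.
  pose proof (wronskian mu H) as HW.
  pose proof (euler_Gc mu) as HG. pose proof (euler_Fc mu H) as HF.
  pose proof (bc_ode mu H) as Hu0. pose proof (dbc_ode mu H) as Hd0.
  pose proof (bc_ode (- mu) (noninteger_opp _ H)) as Hv0.
  (* The constant 1 in the bracket cancels the constant term of F, so that both sides vanish at t =
     0. *)
  assert (E0 : ((bc mu * (fps_const (2 * mu) * Gc mu + fps_const 1) - bc (- mu) * Fc mu)%fps O = 0)).
  { unfold fps_sub, fps_add; simpl. rewrite !bc_0. unfold Fc; simpl; rewrite !bc_0.
    field. pose proof (noninteger_neq0 _ H). lra. }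
  set (u := bc mu) in *; set (v := bc (- mu)) in *; set (G := Gc mu) in *;
    set (F := Fc mu) in *; set (w := dbc mu) in *; set (m := fps_const mu) in *.
  assert (Em : fps_const (2 * mu) = (fps_const 2 * m)%fps) by apply fps_const_mul.
  rewrite Em in *.
  assert (Eo : fps_const (- mu) = fps_opp m)
    by (apply functional_extensionality; intros [|k]; unfold fps_opp, m; simpl; ring).
  rewrite Eo in Hv0.
  assert (Hm : euler m = fps_const 0) by apply euler_const.
  assert (H2 : euler (fps_const 2) = fps_const 0) by apply euler_const.
  assert (H1 : euler (fps_const 1) = fps_const 0) by apply euler_const.
  (* [ring] treats [fps_const 2] as an atom, so 2 = 1 + 1 has to be supplied. *)
  assert (E2 : fps_const 2 = (fps_const 1 + fps_const 1)%fps).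
  { rewrite <- fps_const_add; f_equal; ring. }
  assert (Hu : euler (euler u) = (fps_X * u - m * euler u)%fps).
  { rewrite <- Hu0, euler_add, euler_mul, Hm; ring. }
  assert (Hv : euler (euler v) = (fps_X * v + m * euler v)%fps).
  { rewrite <- Hv0, euler_add, euler_mul.
    replace (euler (fps_opp m)) with (fps_const 0)
     by (rewrite <- Eo; symmetry; apply euler_const). ring. }
  assert (HF' : euler F = (m * (u * u) - m * F)%fps) by (rewrite <- HF; ring).
  assert (Hw : (euler (euler w) + m * euler w + euler u)%fps = (fps_X * w)%fps).
  { rewrite <- Hd0, euler_add, euler_mul, Hm; ring. }
  set (W := (u * (fps_const 2 * m * G + fps_const 1) - v * F)%fps) in *.
  (* Two terms m u^2 v, one from 2 D G = u v - 1 and one from the equation of F, cancel. Only -m u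
     survives of them, and no derivative of G or F remains. *)
  assert (DW : euler W = (euler u * (fps_const 2 * m * G + fps_const 1) - m * u
                          - F * (euler v - m * v))%fps).
  { unfold W. rewrite euler_sub, !euler_mul, euler_add, !euler_mul, Hm, H2, H1, HF'.
    transitivity (euler u * (fps_const 2 * m * G + fps_const 1)
      + u * m * (fps_const 2 * euler G) - (euler v * F + v * (m * (u * u) - m * F)))%fps.
    { ring. }
    rewrite HG. ring. }
  assert (DDW : (euler (euler W) + m * euler W + fps_const 2 * m * euler u)%fps = (fps_X * W)%fps).
  { rewrite DW.
    rewrite !euler_sub, !euler_mul, euler_add, !euler_sub, !euler_mul, Hm, H2, H1, HF', Hu, Hv.
    transitivity ((fps_X * u) * (fps_const 2 * m * G + fps_const 1) - F * (fps_X * v)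
      + euler u * m * (fps_const 2 * euler G)
      - m * euler u - m * (u * u) * (euler v - m * v) - m * m * u
      + fps_const 2 * m * euler u)%fps.
    { ring. }
    rewrite HG.
    (* The terms outside X W are arranged so that the Wronskian appears as a factor of m u; its
       value m cancels the remaining - m u m. *)
    transitivity (fps_X * W + m * u * (v * euler u - u * euler v + m * (u * v))
                  - m * u * m + (fps_const 2 - fps_const 1 - fps_const 1) * m * euler u)%fps.
    { unfold W; ring. }
    rewrite HW. rewrite E2. ring. }
  set (e := (fps_const 2 * m * w - W)%fps).
  assert (He : forall n, e n = 0).
  { apply (euler_ode_unique mu e H).
    - unfold e, fps_sub. rewrite E0. unfold w. simpl. ring.
    - fold m. rewrite euler_add, euler_mul, Hm.
      assert (Dw : euler (fps_const 2 * m * w)%fps = (fps_const 2 * m * euler w)%fps).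
      { rewrite !euler_mul, Hm, H2; ring. }
      assert (DDw : euler (fps_const 2 * m * euler w)%fps = (fps_const 2 * m * euler (euler w))%fps).
      { rewrite !euler_mul, Hm, H2; ring. }
      unfold e. rewrite euler_sub, Dw, euler_sub, DDw.
      transitivity ((fps_const 2 * m) * (euler (euler w) + m * euler w + euler u)
         - (euler (euler W) + m * euler W + fps_const 2 * m * euler u))%fps.
      { ring. }
      rewrite Hw, DDW. ring. }
  apply functional_extensionality; intro n. specialize (He n).
  unfold e, fps_sub in He. lra.
Qed.

(** * Vandermonde convolution and hypergeometric form of the products *)

Lemma conv_sum a b n : conv a b n = sum_f_R0 (fun k => a k * b (n - k)%nat) n.
Proof.
  revert a; induction n as [|n IH]; intros a; [reflexivity|].
  rewrite decomp_sum by lia. simpl conv; rewrite IH; reflexivity.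
Qed.

Fixpoint ff (x : R) (k : nat) : R :=
  match k with O => 1 | S m => x * ff (x - 1) m end.

Lemma ff_S x k : ff x (S k) = ff x k * (x - INR k).
Proof.
  revert x; induction k as [|k IH]; intros x; [simpl; ring|].
  change (ff x (S (S k))) with (x * ff (x - 1) (S k)).
  rewrite IH, S_INR; simpl; ring.
Qed.

Definition binom_ser (x : R) : fps := fun k => ff x k / INR (fact k).

Lemma binom_ser_S x k : INR (S k) * binom_ser x (S k) = (x - INR k) * binom_ser x k.
Proof.
  unfold binom_ser; rewrite ff_S, fact_simpl, mult_INR.
  pose proof (INR_fact_neq_0 k). assert (INR (S k) <> 0) by (apply not_0_INR; lia).
  field; tauto.
Qed.

Lemma one_plus_X_mul (a : fps) :
  ((fps_const 1 + fps_X) * a = a + fps_X * a :> fps)%fps.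
Proof. ring. Qed.

(* This equation characterises the binomial series (1 + X)^x, hence [vandermonde]. *)
Lemma binom_ser_ode x :
  ((fps_const 1 + fps_X) * euler (binom_ser x))%fps
  = (fps_const x * (fps_X * binom_ser x))%fps.
Proof.
  rewrite one_plus_X_mul.
  apply functional_extensionality; intros [|k]; unfold fps_add; rewrite conv_const_l.
  - unfold euler; simpl; ring.
  - rewrite !conv_X_S; unfold euler; rewrite binom_ser_S; ring.
Qed.

Lemma vandermonde x y n :
  conv (binom_ser x) (binom_ser y) n = binom_ser (x + y) n.
Proof.
  set (c := conv (binom_ser x) (binom_ser y)).
  assert (H : ((fps_const 1 + fps_X) * euler c)%fps = (fps_const (x + y) * (fps_X * c))%fps).
  { unfold c; rewrite euler_mul, fps_const_add.
    transitivity (((fps_const 1 + fps_X) * euler (binom_ser x)) * binom_ser y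
      + binom_ser x * ((fps_const 1 + fps_X) * euler (binom_ser y)))%fps; [ring|].
    rewrite !binom_ser_ode; ring. }
  rewrite one_plus_X_mul in H.
  induction n as [|n IH]; [unfold c, binom_ser; simpl; field|].
  apply (f_equal (fun f => f (S n))) in H; unfold fps_add in H.
  rewrite conv_const_l, !conv_X_S in H; unfold euler in H.
  assert (Hn : INR (S n) <> 0) by (apply not_0_INR; lia).
  apply Rmult_eq_reg_l with (INR (S n)); [|exact Hn].
  rewrite binom_ser_S, <- IH; lra.
Qed.

(** A rising factorial splits into its first j factors and the remaining i, which form a falling
    factorial when read downwards. *)
Lemma rf_ff m j i : rf (m + 1) j * ff (m + INR (j + i)) i = rf (m + 1) (j + i).
Proof.
  induction i as [|i IH].
  - rewrite Nat.add_0_r; simpl; ring.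
  - rewrite Nat.add_succ_r; simpl rf; rewrite <- IH; simpl ff.
    change (match (j + i)%nat with O => 1 | S _ => INR (j + i) + 1 end) with (INR (S (j + i))).
    rewrite S_INR.
    replace (m + (INR (j + i) + 1) - 1) with (m + INR (j + i)) by ring.
    ring.
Qed.

(** Over the common denominator (m + 1)_k (n + 1)_k, the quotient (m + 1)_k / (m + 1)_j is the
    falling factorial of m + k of length k - j, and similarly for n. Each summand becomes a product
    of two binomial coefficients whose upper arguments m + k and n + k do not depend on j, so
    Vandermonde applies. *)
Lemma conv_bc m n k : noninteger m -> noninteger n ->
  conv (bc m) (bc n) k
  = ff (m + n + 2 * INR k) k / (INR (fact k) * rf (m + 1) k * rf (n + 1) k).
Proof.
  intros Hm Hn.
  replace (m + n + 2 * INR k) with ((n + INR k) + (m + INR k)) by ring.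
  pose proof (rf_noninteger_neq0 _ k (noninteger_plus1 _ Hm)) as Rm.
  pose proof (rf_noninteger_neq0 _ k (noninteger_plus1 _ Hn)) as Rn.
  transitivity (conv (binom_ser (n + INR k)) (binom_ser (m + INR k)) k
                / (rf (m + 1) k * rf (n + 1) k)).
  2:{ rewrite vandermonde; unfold binom_ser.
      pose proof (INR_fact_neq_0 k); field; tauto. }
  rewrite !conv_sum; unfold Rdiv at 1; rewrite Rmult_comm, scal_sum.
  apply sum_eq; intros j Hj; unfold bc, binom_ser.
  pose proof (rf_ff m j (k - j)) as E1; pose proof (rf_ff n (k - j) j) as E2.
  replace (j + (k - j))%nat with k in E1 by lia.
  replace (k - j + j)%nat with k in E2 by lia.
  rewrite <- E1, <- E2; rewrite <- E1 in Rm; rewrite <- E2 in Rn.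
  pose proof (INR_fact_neq_0 j); pose proof (INR_fact_neq_0 (k - j)).
  field; repeat split; try assumption; intro E;
    first [apply Rm; rewrite E; ring | apply Rn; rewrite E; ring].
Qed.

Lemma rf_head a k : a * rf (a + 1) k = rf a (S k).
Proof.
  induction k as [|k IH]; [simpl; ring|].
  change (rf (a + 1) (S k)) with (rf (a + 1) k * (a + 1 + INR k)).
  change (rf a (S (S k))) with (rf a (S k) * (a + INR (S k))).
  rewrite <- IH, S_INR; ring.
Qed.

(** Finite form of Legendre's duplication formula: the factors of (2 mu + 1)_(2k) are alternately
    2(1/2 + mu + i) and 2(mu + 1 + i). *)
Lemma rf_duplication mu k :
  4 ^ k * rf (mu + 1) k * rf (1 / 2 + mu) k = rf (2 * mu + 1) (k + k).
Proof.
  induction k as [|k IH]; [simpl; ring|].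
  replace (S k + S k)%nat with (S (S (k + k))) by lia.
  change (rf (2 * mu + 1) (S (S (k + k))))
    with (rf (2 * mu + 1) (k + k) * (2 * mu + 1 + INR (k + k)) * (2 * mu + 1 + INR (S (k + k)))).
  rewrite <- IH, S_INR, plus_INR; simpl rf; simpl pow; field.
Qed.

Lemma rf_1 k : rf 1 k = INR (fact k).
Proof.
  induction k as [|k IH]; [reflexivity|].
  simpl rf; rewrite IH, fact_simpl, mult_INR, S_INR; ring.
Qed.

(** The falling factorial in [conv_bc] is (2 mu + 1)_(2k) / (2 mu + 1)_k, and duplication rewrites
    its numerator. This division creates the 0/0 at negative half-integers, hence the second
    hypothesis. The factor mu / (mu + k) is (mu)_k / (mu + 1)_k. *)
Lemma Fc_eq mu k : noninteger mu -> rf (2 * mu + 1) k <> 0 ->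
  Fc mu k = rf mu k * rf (1 / 2 + mu) k
            / (rf (1 + mu) k * (rf (1 + mu) k * rf (1 + 2 * mu) k)) * 4 ^ k / INR (fact k).
Proof.
  intros H R2; unfold Fc; rewrite conv_bc by exact H.
  pose proof (rf_noninteger_neq0 _ k (noninteger_plus1 _ H)) as R1.
  pose proof (rf_ff (2 * mu) k k) as E1; pose proof (rf_duplication mu k) as E2.
  pose proof (rf_head mu k) as E3; change (rf mu (S k)) with (rf mu k * (mu + INR k)) in E3.
  pose proof (noninteger_plus_INR_neq0 mu k H) as Hk.
  pose proof (INR_fact_neq_0 k) as Hf.
  replace (mu + mu + 2 * INR k) with (2 * mu + INR (k + k)) by (rewrite plus_INR; ring).
  replace (1 + mu) with (mu + 1) by ring; replace (1 + 2 * mu) with (2 * mu + 1) by ring.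
  replace (ff (2 * mu + INR (k + k)) k)
    with (4 ^ k * rf (mu + 1) k * rf (1 / 2 + mu) k / rf (2 * mu + 1) k)
    by (rewrite E2, <- E1; field; exact R2).
  replace (rf mu k) with (mu * rf (mu + 1) k / (mu + INR k)) by (rewrite E3; field; exact Hk).
  field; tauto.
Qed.

(** With orders mu and -mu the numerator in [conv_bc] is (2k + 2)! / (k + 1)!, which duplication at
    0 turns into powers of 4 and (3/2)_k. The index is shifted because G has no constant term, and 1
    - mu^2 absorbs the first factors of (1 + mu)_(k + 1) and (1 - mu)_(k + 1). *)
Lemma Gc_eq mu k : noninteger mu ->
  (1 - mu ^ 2) * Gc mu (S k)
  = rf 1 k * (rf 1 k * rf (3 / 2) k)
    / (rf 2 k * (rf 2 k * (rf (2 - mu) k * rf (2 + mu) k))) * 4 ^ k / INR (fact k).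
Proof.
  intros H; unfold Gc; rewrite conv_bc by (try apply noninteger_opp; exact H).
  pose proof (rf_noninteger_neq0 _ (S k) (noninteger_plus1 _ H)) as R1.
  pose proof (rf_noninteger_neq0 _ (S k) (noninteger_plus1 _ (noninteger_opp _ H))) as R2.
  pose proof (rf_ff 0 (S k) (S k)) as E1; pose proof (rf_duplication 0 (S k)) as E2.
  rewrite Rplus_0_l in E1, E2; rewrite Rplus_0_l in E1.
  replace (2 * 0 + 1) with 1 in E2 by ring.
  rewrite <- E2 in E1; clear E2.
  pose proof (INR_fact_neq_0 k) as Hf. pose proof (INR_fact_neq_0 (S k)) as HfS.
  rewrite rf_1 in E1.
  rewrite <- (rf_head (1 / 2 + 0)) in E1.
  replace (1 / 2 + 0 + 1) with (3 / 2) in E1 by field.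
  replace (mu + - mu + 2 * INR (S k)) with (INR (S k + S k)) by (rewrite plus_INR; ring).
  replace (ff (INR (S k + S k)) (S k)) with (4 ^ S k * (1 / 2) * rf (3 / 2) k).
  2:{ apply Rmult_eq_reg_l with (INR (fact (S k))); [rewrite E1; ring|exact HfS]. }
  clear E1.
  rewrite <- (rf_head (mu + 1)) in *; rewrite <- (rf_head (- mu + 1)) in *.
  replace (mu + 1 + 1) with (2 + mu) in * by ring.
  replace (- mu + 1 + 1) with (2 - mu) in * by ring.
  pose proof (rf_head 1 k) as E3; rewrite Rmult_1_l, rf_1 in E3.
  replace (1 + 1) with 2 in E3 by ring.
  rewrite E3, rf_1. rewrite fact_simpl, mult_INR in *. simpl pow.
  assert (INR (S k) <> 0) by (apply not_0_INR; lia).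
  field; repeat split; try assumption; intro E;
    first [apply R1; rewrite E; ring | apply R2; rewrite E; ring].
Qed.

(** * Series with complex argument *)

Lemma noninteger_margin x : noninteger x ->
  exists d, 0 < d /\ forall m : Z, d <= Rabs (x - IZR m).
Proof.
  intros H; destruct (archimed x) as [H1 H2].
  assert (H3 : x <> IZR (up x)) by apply H.
  assert (H4 : x <> IZR (up x - 1)) by apply H.
  rewrite minus_IZR in H4.
  exists (Rmin (x - (IZR (up x) - 1)) (IZR (up x) - x)); split.
  - apply Rmin_glb_lt; lra.
  - intros m; destruct (Z.lt_ge_cases m (up x)) as [L|L].
    + assert (IZR m <= IZR (up x) - 1) by (rewrite <- minus_IZR; apply IZR_le; lia).
      eapply Rle_trans; [apply Rmin_l|]. rewrite Rabs_pos_eq; lra.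
    + apply IZR_le in L. eapply Rle_trans; [apply Rmin_r|].
      rewrite Rabs_minus_sym, Rabs_pos_eq; lra.
Qed.

(** The coefficient bounds rest on the reciprocals 1/(x + h - m), so one B is needed for all
    integers m and all small h. Having B at least 1 orders the powers of B, and d at most 1 lets h^2
    be bounded by |h|. *)
Lemma noninteger_locally x : noninteger x ->
  exists d B, 0 < d <= 1 /\ 1 <= B /\ forall h, Rabs h < d ->
    noninteger (x + h) /\ forall m : Z, Rabs (/ (x + h - IZR m)) <= B.
Proof.
  intros H; destruct (noninteger_margin x H) as [d [Hd Hm]].
  exists (Rmin (d / 2) 1), (Rmax (2 / d) 1); split; [|split; [apply Rmax_r|]].
  { split; [apply Rmin_glb_lt; lra|apply Rmin_r]. }
  intros h Hh.
  assert (Hh' : Rabs h < d / 2) by (eapply Rlt_le_trans; [exact Hh|apply Rmin_l]).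
  assert (K : forall m : Z, d / 2 <= Rabs (x + h - IZR m)).
  { intros m; specialize (Hm m).
    pose proof (Rabs_triang (x + h - IZR m) (- h)) as T.
    replace (x + h - IZR m + - h) with (x - IZR m) in T by ring.
    rewrite Rabs_Ropp in T; lra. }
  split.
  - intros m E; specialize (K m); rewrite E, Rminus_diag, Rabs_R0 in K; lra.
  - intros m; specialize (K m). rewrite Rabs_inv.
    eapply Rle_trans; [|apply Rmax_l].
    replace (2 / d) with (/ (d / 2)) by (field; lra).
    apply Rinv_le_contravar; lra.
Qed.

(** Domination by the coefficients of M exp(D t), that is, exponential type. This form is stable
    under Cauchy products because a product of exponentials is an exponential, see [conv_exp]. *)
Definition entire (a : nat -> R) :=
  exists M D, 0 <= M /\ 0 <= D /\ forall k, Rabs (a k) <= M * (D ^ k / INR (fact k)).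

Lemma pow_fact_pos D k : 0 <= D -> 0 <= D ^ k / INR (fact k).
Proof.
  intros; apply Rmult_le_pos; [apply pow_le; assumption|].
  left; apply Rinv_0_lt_compat, INR_fact_lt_0.
Qed.

Lemma pow_fact_le D E k : 0 <= D <= E -> D ^ k / INR (fact k) <= E ^ k / INR (fact k).
Proof.
  intros; apply Rmult_le_compat_r.
  - left; apply Rinv_0_lt_compat, INR_fact_lt_0.
  - apply pow_incr; assumption.
Qed.

Lemma entire_le a b c : 0 <= c -> (forall k, Rabs (b k) <= c * Rabs (a k)) ->
  entire a -> entire b.
Proof.
  intros Hc H (M & D & HM & HD & HB); exists (c * M), D; repeat split; try assumption.
  - apply Rmult_le_pos; assumption.
  - intros k; rewrite Rmult_assoc; eapply Rle_trans; [apply H|].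
    apply Rmult_le_compat_l; [assumption|apply HB].
Qed.

Lemma entire_add a b : entire a -> entire b -> entire (fps_add a b).
Proof.
  intros (M & D & HM & HD & HB) (M' & D' & HM' & HD' & HB').
  exists (M + M'), (Rmax D D'); repeat split; try lra.
  - eapply Rle_trans; [exact HD|apply Rmax_l].
  - intros k; unfold fps_add. eapply Rle_trans; [apply Rabs_triang|].
    rewrite Rmult_plus_distr_r; apply Rplus_le_compat;
      (eapply Rle_trans; [apply HB || apply HB'|]); apply Rmult_le_compat_l; trivial;
      apply pow_fact_le; split; trivial; [apply Rmax_l|apply Rmax_r].
Qed.

Lemma conv_abs_le a b A B n : (forall k, Rabs (a k) <= A k) -> (forall k, Rabs (b k) <= B k) ->
  Rabs (conv a b n) <= conv A B n.
Proof.
  revert a A; induction n as [|n IH]; intros a A HA HB; simpl.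
  - rewrite Rabs_mult; apply Rmult_le_compat; auto using Rabs_pos.
  - eapply Rle_trans; [apply Rabs_triang|]; apply Rplus_le_compat.
    + rewrite Rabs_mult; apply Rmult_le_compat; auto using Rabs_pos.
    + apply IH; auto.
Qed.

Lemma conv_exp M M' D D' n :
  conv (fun k => M * (D ^ k / INR (fact k))) (fun k => M' * (D' ^ k / INR (fact k))) n
  = M * M' * ((D + D') ^ n / INR (fact n)).
Proof.
  rewrite conv_sum, binomial; unfold Rdiv.
  rewrite (Rmult_comm (sum_f_R0 _ _)), <- Rmult_assoc, scal_sum.
  apply sum_eq; intros i Hi; unfold Binomial.C.
  pose proof (INR_fact_neq_0 i); pose proof (INR_fact_neq_0 n);
    pose proof (INR_fact_neq_0 (n - i)); field; tauto.
Qed.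

Lemma entire_conv a b : entire a -> entire b -> entire (conv a b).
Proof.
  intros (M & D & HM & HD & HB) (M' & D' & HM' & HD' & HB').
  exists (M * M'), (D + D'); repeat split.
  - apply Rmult_le_pos; assumption.
  - lra.
  - intros k; rewrite <- conv_exp; apply conv_abs_le; assumption.
Qed.

Lemma entire_finite2 x y : entire (fun k => match k with O => x | 1%nat => y | _ => 0 end).
Proof.
  exists (Rabs x + Rabs y), 1; pose proof (Rabs_pos x); pose proof (Rabs_pos y).
  repeat split; try lra.
  intros [|[|k]]; [simpl; lra|simpl; lra|].
  rewrite Rabs_R0; apply Rmult_le_pos; [lra|apply pow_fact_pos; lra].
Qed.

Lemma entire_const x : entire (fps_const x).
Proof.
  apply (entire_le (fun k => match k with O => x | 1%nat => 0 | _ => 0 end) _ 1); [lra| |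
    apply entire_finite2].
  intros [|[|k]]; simpl; lra.
Qed.

Lemma entire_X : entire fps_X.
Proof.
  apply (entire_le (fun k => match k with O => 0 | 1%nat => 1 | _ => 0 end) _ 1); [lra| |
    apply entire_finite2].
  intros [|[|k]]; simpl; lra.
Qed.

Lemma ex_series_exp r : ex_series (fun k => r ^ k / INR (fact k)).
Proof.
  exists (exp r); generalize (is_exp_Reals r); unfold is_pseries.
  apply is_series_ext; intros n; rewrite pow_n_pow; reflexivity.
Qed.

(** [p] stands for the real or the imaginary parts of the powers t^k, so one bound serves both
    components. *)
Lemma entire_ex_series a r p : entire a -> 0 <= r -> (forall k, Rabs (p k) <= r ^ k) ->
  ex_series (fun k => Rabs (a k * p k)).
Proof.
  intros (M & D & HM & HD & HB) Hr Hp.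
  apply (@ex_series_le R_AbsRing R_CompleteNormedModule _
           (fun k => M * ((D * r) ^ k / INR (fact k)))).
  - intros k. change (Rabs (Rabs (a k * p k)) <= M * ((D * r) ^ k / INR (fact k))).
    rewrite Rabs_Rabsolu, Rabs_mult, Rpow_mult_distr.
    replace (M * (D ^ k * r ^ k / INR (fact k))) with (M * (D ^ k / INR (fact k)) * r ^ k)
      by (unfold Rdiv; ring).
    apply Rmult_le_compat; auto using Rabs_pos.
  - apply (@ex_series_scal R_AbsRing R_NormedModule M), ex_series_exp.
Qed.

Definition CPS (a : nat -> R) (t : C) : C := CSeries (fun k => RtoC (a k) * t ^ k)%C.

Lemma CPS_Re a t : Re (CPS a t) = Series (fun k => a k * Re (t ^ k)%C).
Proof. apply Series_ext; intros k; apply re_scal_l. Qed.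
Lemma CPS_Im a t : Im (CPS a t) = Series (fun k => a k * Im (t ^ k)%C).
Proof. apply Series_ext; intros k; apply im_scal_l. Qed.

Lemma C_ext (x y : C) : Re x = Re y -> Im x = Im y -> x = y.
Proof. destruct x, y; simpl; intros -> ->; reflexivity. Qed.

Lemma Rabs_Re_Cpow t k : Rabs (Re (t ^ k)%C) <= Cmod t ^ k.
Proof.
  rewrite <- Cmod_pow; eapply Rle_trans; [apply Rmax_l|apply Rmax_Cmod].
Qed.
Lemma Rabs_Im_Cpow t k : Rabs (Im (t ^ k)%C) <= Cmod t ^ k.
Proof.
  rewrite <- Cmod_pow; eapply Rle_trans; [apply Rmax_r|apply Rmax_Cmod].
Qed.

Lemma entire_ex_Re a t : entire a -> ex_series (fun k => Rabs (a k * Re (t ^ k)%C)).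
Proof. intros H; apply (entire_ex_series a (Cmod t)); auto using Cmod_ge_0, Rabs_Re_Cpow. Qed.
Lemma entire_ex_Im a t : entire a -> ex_series (fun k => Rabs (a k * Im (t ^ k)%C)).
Proof. intros H; apply (entire_ex_series a (Cmod t)); auto using Cmod_ge_0, Rabs_Im_Cpow. Qed.

Lemma CPS_add a b t : entire a -> entire b -> CPS (fps_add a b) t = (CPS a t + CPS b t)%C.
Proof.
  intros Ha Hb; apply C_ext.
  - change (Re (CPS (fps_add a b) t) = Re (CPS a t) + Re (CPS b t)).
    rewrite !CPS_Re, <- Series_plus by (apply ex_series_Rabs, entire_ex_Re; assumption).
    apply Series_ext; intros k; unfold fps_add; ring.
  - change (Im (CPS (fps_add a b) t) = Im (CPS a t) + Im (CPS b t)).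
    rewrite !CPS_Im, <- Series_plus by (apply ex_series_Rabs, entire_ex_Im; assumption).
    apply Series_ext; intros k; unfold fps_add; ring.
Qed.

Lemma CPS_scal c a t : CPS (fun k => c * a k) t = (RtoC c * CPS a t)%C.
Proof.
  apply C_ext.
  - change (Re (CPS (fun k => c * a k) t) = c * Re (CPS a t) - 0 * Im (CPS a t)).
    rewrite !CPS_Re, Rmult_0_l, Rminus_0_r, <- Series_scal_l.
    apply Series_ext; intros k; ring.
  - change (Im (CPS (fun k => c * a k) t) = c * Im (CPS a t) + 0 * Re (CPS a t)).
    rewrite !CPS_Im, Rmult_0_l, Rplus_0_r, <- Series_scal_l.
    apply Series_ext; intros k; ring.
Qed.

Lemma Cpow_add (t : C) m n : (t ^ (m + n) = t ^ m * t ^ n)%C.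
Proof. induction m as [|m IH]; simpl; [ring|rewrite IH; ring]. Qed.

(** Real coefficients keep the components apart: each component of the product is a combination of
    two Cauchy products of absolutely convergent real series, recombined through t^k t^(n-k) =
    t^n. *)
Lemma CPS_mul a b t : entire a -> entire b -> CPS (conv a b) t = (CPS a t * CPS b t)%C.
Proof.
  intros Ha Hb.
  pose proof (entire_ex_Re a t Ha) as Pa; pose proof (entire_ex_Im a t Ha) as Qa.
  pose proof (entire_ex_Re b t Hb) as Pb; pose proof (entire_ex_Im b t Hb) as Qb.
  pose proof (Series_correct _ (ex_series_Rabs _ Pa)) as Sa.
  pose proof (Series_correct _ (ex_series_Rabs _ Qa)) as Ta.
  pose proof (Series_correct _ (ex_series_Rabs _ Pb)) as Sb.
  pose proof (Series_correct _ (ex_series_Rabs _ Qb)) as Tb.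
  apply C_ext.
  - change (Re (CPS (conv a b) t) = Re (CPS a t) * Re (CPS b t) - Im (CPS a t) * Im (CPS b t)).
    rewrite !CPS_Re, !CPS_Im; apply is_series_unique.
    eapply is_series_ext;
      [|exact (is_series_minus _ _ _ _ (is_series_mult _ _ _ _ Sa Sb Pa Pb)
                 (is_series_mult _ _ _ _ Ta Tb Qa Qb))].
    intros n. rewrite conv_sum.
    change (sum_f_R0 (fun k => a k * Re (t ^ k)%C * (b (n - k)%nat * Re (t ^ (n - k))%C)) n
      - sum_f_R0 (fun k => a k * Im (t ^ k)%C * (b (n - k)%nat * Im (t ^ (n - k))%C)) n
      = sum_f_R0 (fun k => a k * b (n - k)%nat) n * Re (t ^ n)%C).
    rewrite <- minus_sum, Rmult_comm, scal_sum; apply sum_eq; intros k Hk.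
    replace (t ^ n)%C with (t ^ k * t ^ (n - k))%C by (rewrite <- Cpow_add; f_equal; lia).
    destruct (t ^ k)%C, (t ^ (n - k))%C; simpl; ring.
  - change (Im (CPS (conv a b) t) = Re (CPS a t) * Im (CPS b t) + Im (CPS a t) * Re (CPS b t)).
    rewrite !CPS_Re, !CPS_Im; apply is_series_unique.
    eapply is_series_ext;
      [|exact (is_series_plus _ _ _ _ (is_series_mult _ _ _ _ Sa Tb Pa Qb)
                 (is_series_mult _ _ _ _ Ta Sb Qa Pb))].
    intros n. rewrite conv_sum.
    change (sum_f_R0 (fun k => a k * Re (t ^ k)%C * (b (n - k)%nat * Im (t ^ (n - k))%C)) n
      + sum_f_R0 (fun k => a k * Im (t ^ k)%C * (b (n - k)%nat * Re (t ^ (n - k))%C)) n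
      = sum_f_R0 (fun k => a k * b (n - k)%nat) n * Im (t ^ n)%C).
    rewrite <- sum_plus, Rmult_comm, scal_sum; apply sum_eq; intros k Hk.
    replace (t ^ n)%C with (t ^ k * t ^ (n - k))%C by (rewrite <- Cpow_add; f_equal; lia).
    destruct (t ^ k)%C, (t ^ (n - k))%C; simpl; ring.
Qed.

Lemma is_series_finite2 (f : nat -> R) : (forall k, f (S (S k)) = 0) ->
  is_series f (f O + f 1%nat).
Proof.
  intros H; change (is_lim_seq (sum_n f) (f O + f 1%nat)).
  apply is_lim_seq_ext_loc with (fun _ => f O + f 1%nat); [|apply is_lim_seq_const].
  exists 1%nat; intros [|n] Hn; [lia|]; clear Hn.
  induction n as [|n IH]; [rewrite sum_Sn, sum_O; reflexivity|].
  rewrite sum_Sn, <- IH, H; unfold plus; simpl; ring.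
Qed.

Lemma CPS_const c t : CPS (fps_const c) t = RtoC c.
Proof.
  apply C_ext; rewrite ?CPS_Re, ?CPS_Im;
    (erewrite is_series_unique;
      [|apply is_series_finite2; intros k; apply Rmult_0_l]); destruct t; simpl; ring.
Qed.

Lemma CPS_X t : CPS fps_X t = t.
Proof.
  apply C_ext; rewrite ?CPS_Re, ?CPS_Im;
    (erewrite is_series_unique;
      [|apply is_series_finite2; intros k; apply Rmult_0_l]); destruct t; simpl; ring.
Qed.

(** The three bounds are proved together by induction, after multiplication by k!. One step produces
    one, two and three terms with factors at most B, B^2 and B^3 respectively, whence the bases B, 2
    B^2 and 3 B^3. *)
Lemma bc_dbc_bounds mu h B : 1 <= B -> noninteger mu -> noninteger (mu + h) ->
  (forall m : Z, Rabs (/ (mu - IZR m)) <= B) ->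
  (forall m : Z, Rabs (/ (mu + h - IZR m)) <= B) ->
  forall k, Rabs (bc mu k) <= B ^ k / INR (fact k) /\
    Rabs (dbc mu k) <= (2 * B ^ 2) ^ k / INR (fact k) /\
    Rabs (bc (mu + h) k - bc mu k - h * dbc mu k) <= h ^ 2 * ((3 * B ^ 3) ^ k / INR (fact k)).
Proof.
  intros HB Hn Hn' H0 H1 k.
  assert (K : Rabs (bc mu k * INR (fact k)) <= B ^ k /\
    Rabs (dbc mu k * INR (fact k)) <= (2 * B ^ 2) ^ k /\
    Rabs ((bc (mu + h) k - bc mu k - h * dbc mu k) * INR (fact k))
      <= h ^ 2 * (3 * B ^ 3) ^ k).
  { induction k as [|k [I1 [I2 I3]]].
    - simpl dbc; rewrite !bc_0; simpl pow; simpl fact; simpl INR.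
      replace ((1 - 1 - h * 0) * 1) with 0 by ring.
      rewrite !Rmult_1_r, Rabs_R0, Rabs_R1.
      pose proof (pow2_ge_0 h); simpl in *; repeat split; lra.
    - rewrite !bc_S by assumption.
      change (dbc mu (S k)) with
        ((dbc mu k / (mu + INR (S k)) - bc mu k / (mu + INR (S k)) ^ 2) / INR (S k)).
      rewrite fact_simpl, mult_INR.
      set (f := INR (fact k)) in *.
      assert (Hk : INR (S k) <> 0) by (apply not_0_INR; lia).
      pose proof (noninteger_plus_INR_neq0 mu (S k) Hn) as N1.
      pose proof (noninteger_plus_INR_neq0 (mu + h) (S k) Hn') as N2.
      set (y := / (mu + INR (S k))); set (x := / (mu + h + INR (S k))).
      assert (Hy : Rabs y <= B).
      { specialize (H0 (- Z.of_nat (S k))%Z); rewrite opp_IZR, <- INR_IZR_INZ in H0.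
        unfold y; replace (mu + INR (S k)) with (mu - - INR (S k)) by ring; exact H0. }
      assert (Hx : Rabs x <= B).
      { specialize (H1 (- Z.of_nat (S k))%Z); rewrite opp_IZR, <- INR_IZR_INZ in H1.
        unfold x; replace (mu + h + INR (S k)) with (mu + h - - INR (S k)) by ring; exact H1. }
      set (a := bc mu k) in *; set (a' := bc (mu + h) k) in *; set (b := dbc mu k) in *.
      replace (a / (mu + INR (S k)) / INR (S k) * (INR (S k) * f)) with (a * f * y)
        by (unfold y; field; tauto).
      replace ((b / (mu + INR (S k)) - a / (mu + INR (S k)) ^ 2) / INR (S k) * (INR (S k) * f))
        with (b * f * y - a * f * (y * y)) by (unfold y; field; tauto).
      (* Since x - y = -h x y, the new remainder is x times the old one plus h^2 times quantities
         already bounded; no second derivative in the order is needed. *)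
      replace ((a' / (mu + h + INR (S k)) / INR (S k) - a / (mu + INR (S k)) / INR (S k)
         - h * ((b / (mu + INR (S k)) - a / (mu + INR (S k)) ^ 2) / INR (S k))) * (INR (S k) * f))
        with ((a' - a - h * b) * f * x + (h ^ 2 * (a * f * (x * (y * y)))
              - h ^ 2 * (b * f * (x * y)))) by (unfold x, y; field; tauto).
      assert (Hyy : Rabs (y * y) <= B * B)
        by (rewrite Rabs_mult; apply Rmult_le_compat; auto using Rabs_pos).
      assert (Hxy : Rabs (x * y) <= B * B)
        by (rewrite Rabs_mult; apply Rmult_le_compat; auto using Rabs_pos).
      assert (Hxyy : Rabs (x * (y * y)) <= B * (B * B))
        by (rewrite Rabs_mult; apply Rmult_le_compat; auto using Rabs_pos).
      assert (P1 : B ^ k <= (2 * B ^ 2) ^ k) by (apply pow_incr; simpl; nra).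
      assert (P2 : (2 * B ^ 2) ^ k <= (3 * B ^ 3) ^ k).
      { apply pow_incr; simpl. assert (1 <= B * B) by nra. split; [nra|].
        assert (B * B <= B * (B * B)) by nra. nra. }
      assert (P0 : 0 <= B ^ k) by (apply pow_le; lra).
      pose proof (pow2_ge_0 h) as Hh.
      assert (BB : B <= B * B) by nra.
      assert (BBB : B * B <= B * (B * B)) by nra.
      split; [|split].
      + rewrite Rabs_mult; simpl; rewrite Rmult_comm.
        apply Rmult_le_compat; auto using Rabs_pos.
      + eapply Rle_trans; [apply Rabs_triang|]; rewrite Rabs_Ropp, !(Rabs_mult (_ * f)).
        assert (Rabs (b * f) * Rabs y <= (2 * B ^ 2) ^ k * (B * B))
          by (apply Rmult_le_compat; auto using Rabs_pos; lra).
        assert (Rabs (a * f) * Rabs (y * y) <= (2 * B ^ 2) ^ k * (B * B))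
          by (apply Rmult_le_compat; auto using Rabs_pos; lra).
        simpl; simpl in *; lra.
      + eapply Rle_trans; [apply Rabs_triang|].
        assert (T1 : Rabs ((a' - a - h * b) * f * x) <= h ^ 2 * (3 * B ^ 3) ^ k * (B * (B * B)))
          by (rewrite Rabs_mult; apply Rmult_le_compat; auto using Rabs_pos; lra).
        assert (T2 : Rabs (a * f * (x * (y * y))) <= (3 * B ^ 3) ^ k * (B * (B * B)))
          by (rewrite Rabs_mult; apply Rmult_le_compat; auto using Rabs_pos; lra).
        assert (T3 : Rabs (b * f * (x * y)) <= (3 * B ^ 3) ^ k * (B * (B * B)))
          by (rewrite Rabs_mult; apply Rmult_le_compat; auto using Rabs_pos; lra).
        assert (T4 : Rabs (h ^ 2 * (a * f * (x * (y * y))) - h ^ 2 * (b * f * (x * y)))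
           <= h ^ 2 * ((3 * B ^ 3) ^ k * (B * (B * B)) + (3 * B ^ 3) ^ k * (B * (B * B)))).
        { rewrite <- Rmult_minus_distr_l, Rabs_mult, (Rabs_pos_eq _ Hh).
          apply Rmult_le_compat_l; [exact Hh|].
          eapply Rle_trans; [apply Rabs_triang|]; rewrite Rabs_Ropp; lra. }
        replace (h ^ 2 * (3 * B ^ 3) ^ S k)
          with (h ^ 2 * (3 * B ^ 3) ^ k * (B * (B * B))
                + h ^ 2 * ((3 * B ^ 3) ^ k * (B * (B * B)) + (3 * B ^ 3) ^ k * (B * (B * B))))
          by (simpl; ring).
        lra. }
  assert (Hf : 0 < INR (fact k)) by apply INR_fact_lt_0.
  assert (Q : forall x y, Rabs (x * INR (fact k)) <= y -> Rabs x <= y / INR (fact k)).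
  { intros x y Hxy; rewrite Rabs_mult, (Rabs_pos_eq (INR (fact k))) in Hxy by lra.
    apply Rmult_le_reg_r with (INR (fact k)); [exact Hf|].
    unfold Rdiv; rewrite Rmult_assoc, Rinv_l, Rmult_1_r by lra; exact Hxy. }
  destruct K as [K1 [K2 K3]]; repeat split.
  - apply Q, K1.
  - apply Q, K2.
  - eapply Rle_trans; [apply Q, K3|]; right; unfold Rdiv; ring.
Qed.

(** * The gamma function *)

Lemma is_derive_quadratic f x l K d : 0 < d ->
  (forall h, Rabs h < d -> Rabs (f (x + h) - f x - h * l) <= h ^ 2 * K) ->
  is_derive f x l.
Proof.
  intros Hd H; apply is_derive_Reals; intros eps Heps.
  pose proof (Rabs_pos K) as HK.
  assert (Hp : 0 < Rmin d (eps / (Rabs K + 1))).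
  { apply Rmin_glb_lt; [exact Hd|]; apply Rdiv_lt_0_compat; lra. }
  exists (mkposreal _ Hp); simpl; intros h Hh0 Hh.
  assert (H1 : Rabs h < d) by (eapply Rlt_le_trans; [exact Hh|apply Rmin_l]).
  assert (H2 : Rabs h < eps / (Rabs K + 1)) by (eapply Rlt_le_trans; [exact Hh|apply Rmin_r]).
  specialize (H h H1).
  pose proof (Rabs_pos_lt h Hh0) as Hpos.
  replace ((f (x + h) - f x) / h - l) with ((f (x + h) - f x - h * l) / h) by (field; exact Hh0).
  unfold Rdiv; rewrite Rabs_mult, Rabs_inv.
  apply Rmult_lt_reg_r with (Rabs h); [exact Hpos|].
  rewrite Rmult_assoc, Rinv_l, Rmult_1_r by lra.
  eapply Rle_lt_trans; [exact H|].
  rewrite <- (pow2_abs h).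
  apply Rle_lt_trans with (Rabs h ^ 2 * (Rabs K + 1)).
  { apply Rmult_le_compat_l; [apply pow2_ge_0|]. pose proof (Rle_abs K); lra. }
  apply Rmult_lt_compat_r with (r := Rabs K + 1) in H2; [|lra].
  unfold Rdiv in H2; rewrite Rmult_assoc, Rinv_l, Rmult_1_r in H2 by lra.
  replace (Rabs h ^ 2 * (Rabs K + 1)) with (Rabs h * (Rabs K + 1) * Rabs h) by ring.
  apply Rmult_lt_compat_r; assumption.
Qed.

Lemma ex_series_le_R (a b : nat -> R) :
  (forall k, Rabs (a k) <= b k) -> ex_series b -> ex_series a.
Proof. exact (@ex_series_le R_AbsRing R_CompleteNormedModule a b). Qed.

Lemma ex_series_scal_R c (a : nat -> R) : ex_series a -> ex_series (fun k => c * a k).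
Proof. exact (@ex_series_scal R_AbsRing R_NormedModule c a). Qed.

Lemma Series_le_abs (a b : nat -> R) :
  (forall k, Rabs (a k) <= b k) -> ex_series b -> Rabs (Series a) <= Series b.
Proof.
  intros H Hb; eapply Rle_trans; [apply Series_Rabs|apply Series_le].
  - apply ex_series_le_R with b; [|exact Hb]; intros k; rewrite Rabs_Rabsolu; apply H.
  - intros k; split; [apply Rabs_pos|apply H].
  - exact Hb.
Qed.

(** Termwise differentiation from a summable second-order remainder: the derivative series has to
    converge only at the point x itself. *)
Lemma is_derive_Series_quadratic (f : nat -> R -> R) (l m : nat -> R) x d : 0 < d ->
  ex_series (fun k => f k x) -> ex_series l -> ex_series m ->
  (forall k h, Rabs h < d -> Rabs (f k (x + h) - f k x - h * l k) <= h ^ 2 * m k) ->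
  is_derive (fun y => Series (fun k => f k y)) x (Series l).
Proof.
  intros Hd Hf Hl Hm H; apply is_derive_quadratic with (Series m) d; [exact Hd|].
  intros h Hh.
  pose proof (ex_series_scal_R h _ Hl) as Hhl.
  (* Convergence at x + h is not assumed; it follows from that of the remainder. *)
  assert (Hr : ex_series (fun k => f k (x + h) - f k x - h * l k)).
  { apply ex_series_le_R with (fun k => h ^ 2 * m k); [auto|].
    apply ex_series_scal_R, Hm. }
  assert (Hfh : ex_series (fun k => f k (x + h))).
  { eapply ex_series_ext; [|exact (ex_series_plus _ _ Hr (ex_series_plus _ _ Hf Hhl))].
    intros k; unfold plus; simpl; ring. }
  rewrite <- Series_scal_l, <- Series_minus, <- Series_minus, <- Series_scal_l;
    try assumption.
  - apply Series_le_abs; [auto|apply ex_series_scal_R, Hm].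
  - exact (ex_series_minus _ _ Hfh Hf).
Qed.

Lemma ln_1p_le y : -1 < y -> ln (1 + y) <= y.
Proof.
  intros Hy; rewrite <- (ln_exp y) at 2; apply ln_le; [lra|].
  destruct (Req_dec y 0) as [->|N]; [rewrite exp_0; lra|].
  left; apply exp_ineq1; exact N.
Qed.

Lemma ln_1p_ge y : -1 < y -> y / (1 + y) <= ln (1 + y).
Proof.
  intros Hy.
  assert (H : ln (1 + - (y / (1 + y))) <= - (y / (1 + y))).
  { apply ln_1p_le.
    apply Rmult_lt_reg_r with (1 + y); [lra|].
    replace (- (y / (1 + y)) * (1 + y)) with (- y) by (field; lra). lra. }
  replace (1 + - (y / (1 + y))) with (/ (1 + y)) in H by (field; lra).
  rewrite ln_Rinv in H by lra; lra.
Qed.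

Lemma ln_1p_ge_nonneg y : 0 <= y -> y - y ^ 2 <= ln (1 + y).
Proof.
  intros Hy; eapply Rle_trans; [|apply ln_1p_ge; lra].
  apply Rmult_le_reg_r with (1 + y); [lra|].
  replace (y / (1 + y) * (1 + y)) with y by (field; lra).
  assert (0 <= y ^ 3) by (apply pow_le; exact Hy). nra.
Qed.

Lemma ln_1p_quadratic y : -1 / 2 <= y -> Rabs (ln (1 + y) - y) <= 2 * y ^ 2.
Proof.
  intros Hy; pose proof (ln_1p_le y ltac:(lra)) as U; pose proof (ln_1p_ge y ltac:(lra)) as L.
  rewrite Rabs_left1 by lra.
  apply Rle_trans with (y - y / (1 + y)); [lra|].
  apply Rmult_le_reg_r with (1 + y); [lra|].
  replace ((y - y / (1 + y)) * (1 + y)) with (y ^ 2) by (field; lra).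
  pose proof (pow2_ge_0 y); nra.
Qed.

Lemma is_lim_seq_inv_INR : is_lim_seq (fun n => / INR (S n)) 0.
Proof.
  apply (is_lim_seq_incr_1 (fun n => / INR n)).
  apply (is_lim_seq_inv INR p_infty); [apply is_lim_seq_INR|discriminate].
Qed.

Lemma ex_series_inv_sq : ex_series (fun k => / INR (S k) ^ 2).
Proof.
  apply ex_series_le_R with (fun k => 2 * (/ INR (S k) - / INR (S (S k)))).
  - intros k.
    assert (0 < INR (S k)) by (apply lt_0_INR; lia).
    assert (E : 1 <= INR (S k)) by (rewrite S_INR; pose proof (pos_INR k); lra).
    rewrite Rabs_pos_eq by (left; apply Rinv_0_lt_compat, pow_lt; lra).
    rewrite (S_INR (S k)).
    set (N := INR (S k)) in *.
    replace (2 * (/ N - / (N + 1))) with (/ (N * (N + 1) / 2)) by (field; lra).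
    apply Rinv_le_contravar; nra.
  - apply ex_series_scal_R; exists 1.
    change (is_lim_seq (sum_n (fun k => / INR (S k) - / INR (S (S k)))) 1).
    apply is_lim_seq_ext with (fun n => 1 - / INR (S (S n))).
    + intros n; induction n as [|n IH]; [rewrite sum_O; simpl; field|].
      rewrite sum_Sn, <- IH; unfold plus; simpl; lra.
    + replace (Finite 1) with (Finite (1 - 0)) by (f_equal; ring).
      apply is_lim_seq_minus'; [apply is_lim_seq_const|].
      apply (is_lim_seq_incr_1 (fun n => / INR (S n))), is_lim_seq_inv_INR.
Qed.

(* For x > 0, x * Gamma x = exp (sum of [gamma_term x]). *)
Definition gamma_term (x : R) (k : nat) : R := x * ln (1 + / INR (S k)) - ln (1 + x / INR (S k)).
Definition gamma_term' (x : R) (k : nat) : R := ln (1 + / INR (S k)) - / (INR (S k) + x).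

Lemma INR_S_ge1 k : 1 <= INR (S k).
Proof. rewrite S_INR; pose proof (pos_INR k); lra. Qed.

Lemma ln_1p_inv_bounds k : / INR (S k) - / INR (S k) ^ 2 <= ln (1 + / INR (S k)) <= / INR (S k).
Proof.
  pose proof (INR_S_ge1 k) as HN.
  assert (Hi : 0 < / INR (S k)) by (apply Rinv_0_lt_compat; lra).
  split; [|apply ln_1p_le; lra].
  rewrite <- pow_inv; apply ln_1p_ge_nonneg; lra.
Qed.

Lemma ex_series_gamma_term x : 0 < x -> ex_series (gamma_term x).
Proof.
  intros Hx; apply ex_series_le_R with (fun k => (x + x ^ 2) * / INR (S k) ^ 2).
  2: apply ex_series_scal_R, ex_series_inv_sq.
  intros k; unfold gamma_term.
  pose proof (INR_S_ge1 k) as HN; pose proof (ln_1p_inv_bounds k) as [L1 U1].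
  set (N := INR (S k)) in *.
  assert (Hi : 0 < / N) by (apply Rinv_0_lt_compat; lra).
  assert (H0 : 0 <= x / N) by (unfold Rdiv; nra).
  pose proof (ln_1p_ge_nonneg (x / N) H0) as L2.
  pose proof (ln_1p_le (x / N) ltac:(lra)) as U2.
  rewrite <- pow_inv in *. unfold Rdiv in *. set (n := / N) in *.
  assert (0 <= n ^ 2) by apply pow2_ge_0.
  apply Rabs_le; split; nra.
Qed.

Lemma ex_series_gamma_term' x : 0 < x -> ex_series (gamma_term' x).
Proof.
  intros Hx; apply ex_series_le_R with (fun k => (1 + x) * / INR (S k) ^ 2).
  2: apply ex_series_scal_R, ex_series_inv_sq.
  intros k; unfold gamma_term'.
  pose proof (INR_S_ge1 k) as HN; pose proof (ln_1p_inv_bounds k) as [L1 U1].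
  set (N := INR (S k)) in *.
  assert (Hi : 0 < / N) by (apply Rinv_0_lt_compat; lra).
  assert (H2 : / (N + x) <= / N) by (apply Rinv_le_contravar; lra).
  assert (H3 : / N - x * / N ^ 2 <= / (N + x)).
  { apply Rmult_le_reg_r with (N ^ 2 * (N + x)); [apply Rmult_lt_0_compat; nra|].
    replace ((/ N - x * / N ^ 2) * (N ^ 2 * (N + x))) with (N ^ 2 - x ^ 2) by (field; lra).
    replace (/ (N + x) * (N ^ 2 * (N + x))) with (N ^ 2) by (field; lra).
    pose proof (pow2_ge_0 x); lra. }
  assert (0 < / N ^ 2) by (apply Rinv_0_lt_compat; nra).
  apply Rabs_le; split; nra.
Qed.

Lemma is_derive_Series_gamma_term x : 0 < x ->
  is_derive (fun y => Series (gamma_term y)) x (Series (gamma_term' x)).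
Proof.
  intros Hx.
  apply (is_derive_Series_quadratic (fun k y => gamma_term y k) _
          (fun k => 2 * / INR (S k) ^ 2) x (x / 2)); [lra| | | |].
  - apply ex_series_gamma_term, Hx.
  - apply ex_series_gamma_term', Hx.
  - apply ex_series_scal_R, ex_series_inv_sq.
  - intros k h Hh; unfold gamma_term, gamma_term'.
    pose proof (INR_S_ge1 k) as HN; set (N := INR (S k)) in *.
    apply Rabs_lt_between in Hh.
    assert (Hi : 0 < / N) by (apply Rinv_0_lt_compat; lra).
    assert (Hi2 : 0 < / (N + x)) by (apply Rinv_0_lt_compat; lra).
    assert (P1 : 0 < x / N) by (unfold Rdiv; nra).
    assert (E1 : -1 / 2 <= h / (N + x)).
    { apply Rmult_le_reg_r with (N + x); [lra|].
      replace (h / (N + x) * (N + x)) with h by (field; lra). lra. }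
    (* Splitting 1 + (x + h)/N as (1 + x/N)(1 + h/(N + x)) reduces the remainder to ln(1 + y) - y at
       y = h/(N + x); the radius x/2 keeps y >= -1/2. *)
    replace (ln (1 + (x + h) / N)) with (ln (1 + x / N) + ln (1 + h / (N + x))).
    2:{ rewrite <- ln_mult by lra; f_equal; field; lra. }
    match goal with |- Rabs ?e <= _ =>
      replace e with (- (ln (1 + h / (N + x)) - h / (N + x))) by (unfold Rdiv; ring) end.
    rewrite Rabs_Ropp; eapply Rle_trans; [apply ln_1p_quadratic, E1|].
    unfold Rdiv; rewrite Rpow_mult_distr.
    assert (/ (N + x) <= / N) by (apply Rinv_le_contravar; lra).
    assert ((/ (N + x)) ^ 2 <= / N ^ 2) by (rewrite <- pow_inv; apply pow_incr; lra).
    pose proof (pow2_ge_0 h); nra.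
Qed.

(** * Euler's limit and the functional equation *)

Definition gamma_seq (x : R) (n : nat) : R :=
  INR (fact n) * Rpower (INR n) x / prod_f_R0 (fun j => x + INR j) n.

Lemma Gamma_unique x (l : R) : is_lim_seq (gamma_seq x) l -> Gamma x = l.
Proof. intros H; unfold Gamma; exact (f_equal real (is_lim_seq_unique _ _ H)). Qed.

Lemma prod_f_R0_neq0 f n : (forall j, f j <> 0) -> prod_f_R0 f n <> 0.
Proof.
  intros H; induction n as [|n IH]; simpl; [apply H|].
  apply Rmult_integral_contrapositive_currified; auto.
Qed.

(** The logarithms ln(1 + 1/k) for k up to n + 1 telescope to ln(n + 2), one step beyond the base n
    + 1 of the power in Euler's formula; the last summand of the exponent removes the excess. The
    index is [S n] because at 0 the power rests on a default value of [ln]. *)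
Lemma gamma_seq_S x n : 0 < x ->
  gamma_seq x (S n)
  = exp (sum_n (gamma_term x) n + x * - ln (1 + / INR (S n))) / x.
Proof.
  intros Hx; unfold gamma_seq, Rpower; induction n as [|n IH].
  - rewrite sum_O; unfold gamma_term; simpl.
    rewrite ln_1.
    replace (x * ln (1 + / 1) - ln (1 + x / 1) + x * - ln (1 + / 1)) with (- ln (1 + x))
      by (rewrite Rdiv_1_r; ring).
    rewrite exp_Ropp, exp_ln, Rmult_0_r, exp_0 by lra; field; lra.
  - pose proof (INR_S_ge1 n) as HN.
    replace (sum_n (gamma_term x) (S n)) with (sum_n (gamma_term x) n + gamma_term x (S n))
      by (rewrite sum_Sn; reflexivity).
    set (s := sum_n (gamma_term x) n) in *.
    unfold gamma_term.
    change (prod_f_R0 (fun j => x + INR j) (S (S n)))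
      with (prod_f_R0 (fun j => x + INR j) (S n) * (x + INR (S (S n)))).
    set (P := prod_f_R0 (fun j => x + INR j) (S n)) in *.
    assert (HP : P <> 0).
    { apply prod_f_R0_neq0; intros j; pose proof (pos_INR j); lra. }
    rewrite (fact_simpl (S n)), mult_INR.
    set (f := INR (fact (S n))) in *.
    rewrite (S_INR (S n)) in *. set (N := INR (S n)) in *.
    assert (Hl : ln (N + 1) = ln N + ln (1 + / N)).
    { rewrite <- ln_mult; [f_equal; field; lra|lra|].
      pose proof (Rinv_0_lt_compat N ltac:(lra)); lra. }
    assert (Ef : f = P * (exp (s + x * - ln (1 + / N)) / x) * exp (- (x * ln N))).
    { rewrite <- IH, exp_Ropp; field; split; [apply Rgt_not_eq, exp_pos|exact HP]. }
    rewrite Ef, Hl.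
    match goal with |- _ = exp ?e / x =>
      replace e with ((s + x * - ln (1 + / N)) + (- (x * ln N)) + x * (ln N + ln (1 + / N))
       + - ln (1 + x / (N + 1))) by ring end.
    rewrite !exp_plus, (exp_Ropp (ln (1 + x / (N + 1)))), exp_ln.
    2:{ pose proof (Rinv_0_lt_compat (N + 1) ltac:(lra)); unfold Rdiv; nra. }
    field; repeat split; try lra; exact HP.
Qed.

Lemma gamma_seq_lim_pos x : 0 < x ->
  is_lim_seq (gamma_seq x) (exp (Series (gamma_term x)) / x).
Proof.
  intros Hx; apply is_lim_seq_incr_1.
  apply is_lim_seq_ext with
    (fun n => exp (sum_n (gamma_term x) n + x * - ln (1 + / INR (S n))) * / x).
  { intros n; symmetry; apply gamma_seq_S, Hx. }
  apply (is_lim_seq_scal_r _ (/ x) (Finite _)).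
  apply (is_lim_seq_continuous exp); [apply derivable_continuous, derivable_exp|].
  replace (Series (gamma_term x)) with (Series (gamma_term x) + x * - ln (1 + 0))
    by (rewrite Rplus_0_r, ln_1; ring).
  apply is_lim_seq_plus'; [exact (Series_correct _ (ex_series_gamma_term x Hx))|].
  apply (is_lim_seq_scal_l _ x (Finite _)).
  apply (proj1 (is_lim_seq_opp (fun n => ln (1 + / INR (S n))) (Finite (ln (1 + 0))))).
  apply (is_lim_seq_continuous ln).
  - apply derivable_continuous_pt; exists (/ (1 + 0)); apply derivable_pt_lim_ln; lra.
  - apply is_lim_seq_plus'; [apply is_lim_seq_const|apply is_lim_seq_inv_INR].
Qed.

(** The complement of the poles 0, -1, -2, ..., in a form visibly stable under adding 1. *)
Definition gamma_dom (x : R) := 0 < x \/ noninteger x.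

Lemma gamma_dom_plus1 x : gamma_dom x -> gamma_dom (x + 1).
Proof. intros [H|H]; [left; lra|right; apply noninteger_plus1, H]. Qed.

Lemma gamma_dom_neq0 x : gamma_dom x -> x <> 0.
Proof. intros [H|H]; [lra|apply noninteger_neq0, H]. Qed.

Lemma gamma_dom_plus_INR x n : gamma_dom x -> gamma_dom (x + INR n).
Proof.
  intros [H|H]; [left; pose proof (pos_INR n); lra|right; apply noninteger_plus_INR, H].
Qed.

Lemma gamma_dom_locally x : gamma_dom x -> locally x gamma_dom.
Proof.
  intros [H|H].
  - exists (mkposreal x H); intros y Hy; left.
    apply Rabs_lt_between in Hy; unfold minus, plus, opp in Hy; simpl in Hy; lra.
  - destruct (noninteger_locally x H) as (d & B & [Hd _] & _ & Hn).
    exists (mkposreal d Hd); intros y Hy; right.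
    replace y with (x + (y - x)) by ring; apply Hn, Hy.
Qed.

(** The functional equation holds at finite n up to a factor tending to 1. It carries convergence
    from the positive half-line to the whole domain by unit steps, and yields [Gamma_plus1] in the
    limit. *)
Lemma gamma_seq_plus1 x n : gamma_dom x -> (0 < n)%nat ->
  gamma_seq x n = gamma_seq (x + 1) n * (1 + (x + 1) * / INR n) / x.
Proof.
  intros Hx Hn; unfold gamma_seq.
  assert (HN : 0 < INR n) by (apply lt_0_INR; lia).
  rewrite Rpower_plus, Rpower_1 by exact HN.
  assert (E : forall m, prod_f_R0 (fun j => x + INR j) m * (x + INR (S m))
                = x * prod_f_R0 (fun j => x + 1 + INR j) m).
  { induction m as [|m IH]; [simpl; ring|].
    change (prod_f_R0 (fun j => x + INR j) m * (x + INR (S m)) * (x + INR (S (S m)))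
      = x * (prod_f_R0 (fun j => x + 1 + INR j) m * (x + 1 + INR (S m)))).
    rewrite <- Rmult_assoc, <- IH, (S_INR (S m)); ring. }
  specialize (E n).
  assert (P1 : prod_f_R0 (fun j => x + INR j) n <> 0).
  { apply prod_f_R0_neq0; intros j; apply gamma_dom_neq0, gamma_dom_plus_INR, Hx. }
  assert (P2 : prod_f_R0 (fun j => x + 1 + INR j) n <> 0).
  { apply prod_f_R0_neq0; intros j.
    apply gamma_dom_neq0, gamma_dom_plus_INR, gamma_dom_plus1, Hx. }
  pose proof (gamma_dom_neq0 x Hx) as H0.
  replace (prod_f_R0 (fun j => x + INR j) n) with
    (x * prod_f_R0 (fun j => x + 1 + INR j) n / (x + INR (S n))).
  2:{ rewrite <- E; field; apply gamma_dom_neq0, gamma_dom_plus_INR, Hx. }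
  pose proof (gamma_dom_neq0 _ (gamma_dom_plus_INR x (S n) Hx)) as HS.
  rewrite S_INR in *; field; repeat split; try assumption; lra.
Qed.

Lemma exists_plus_INR_pos x : exists m, 0 < x + INR m.
Proof.
  destruct (nfloor_ex (Rabs x)) as [n Hn]; [apply Rabs_pos|].
  exists (S n); rewrite S_INR; pose proof (Rabs_maj2 x); lra.
Qed.

Lemma gamma_seq_lim x : gamma_dom x ->
  exists l : R, l <> 0 /\ is_lim_seq (gamma_seq x) l.
Proof.
  intros Hx.
  destruct (exists_plus_INR_pos x) as [m Hm]; revert x Hx Hm; induction m as [|m IH]; intros x Hx Hm.
  - simpl in Hm; rewrite Rplus_0_r in Hm.
    exists (exp (Series (gamma_term x)) / x); split; [|apply gamma_seq_lim_pos, Hm].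
    apply Rgt_not_eq, Rdiv_lt_0_compat; [apply exp_pos|exact Hm].
  - rewrite S_INR in Hm.
    destruct (IH (x + 1) (gamma_dom_plus1 x Hx) ltac:(lra)) as (l & Hl & L).
    pose proof (gamma_dom_neq0 x Hx) as H0.
    exists (l / x); split.
    { apply Rmult_integral_contrapositive_currified; [exact Hl|apply Rinv_neq_0_compat, H0]. }
    apply is_lim_seq_incr_1.
    apply is_lim_seq_ext with
      (fun n => gamma_seq (x + 1) (S n) * (1 + (x + 1) * / INR (S n)) * / x).
    { intros n; symmetry; apply (gamma_seq_plus1 x (S n) Hx); lia. }
    apply (is_lim_seq_scal_r _ (/ x) (Finite _)).
    replace l with (l * (1 + (x + 1) * 0)) by ring.
    apply is_lim_seq_mult'; [apply -> (is_lim_seq_incr_1 (gamma_seq (x + 1))); exact L|].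
    apply is_lim_seq_plus'; [apply is_lim_seq_const|].
    apply (is_lim_seq_scal_l _ (x + 1) (Finite _)), is_lim_seq_inv_INR.
Qed.

Lemma Gamma_correct x : gamma_dom x -> is_lim_seq (gamma_seq x) (Gamma x).
Proof.
  intros H; destruct (gamma_seq_lim x H) as (l & _ & L); rewrite (Gamma_unique x l L); exact L.
Qed.

Lemma Gamma_neq0 x : gamma_dom x -> Gamma x <> 0.
Proof.
  intros H; destruct (gamma_seq_lim x H) as (l & N & L); rewrite (Gamma_unique x l L); exact N.
Qed.

Lemma Gamma_plus1 x : gamma_dom x -> Gamma (x + 1) = x * Gamma x.
Proof.
  intros Hx.
  pose proof (gamma_dom_neq0 x Hx) as H0.
  enough (Gamma x = Gamma (x + 1) / x) by (rewrite H; field; exact H0).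
  apply Gamma_unique, is_lim_seq_incr_1.
  apply is_lim_seq_ext with
    (fun n => gamma_seq (x + 1) (S n) * (1 + (x + 1) * / INR (S n)) * / x).
  { intros n; symmetry; apply (gamma_seq_plus1 x (S n) Hx); lia. }
  apply (is_lim_seq_scal_r _ (/ x) (Finite _)).
  replace (Gamma (x + 1)) with (Gamma (x + 1) * (1 + (x + 1) * 0)) by ring.
  apply is_lim_seq_mult'.
  - apply -> (is_lim_seq_incr_1 (gamma_seq (x + 1))); apply Gamma_correct, gamma_dom_plus1, Hx.
  - apply is_lim_seq_plus'; [apply is_lim_seq_const|].
    apply (is_lim_seq_scal_l _ (x + 1) (Finite _)), is_lim_seq_inv_INR.
Qed.

Lemma Gamma_rf x k : gamma_dom x -> Gamma (x + INR k) = rf x k * Gamma x.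
Proof.
  intros Hx; induction k as [|k IH]; [simpl; rewrite Rplus_0_r; ring|].
  rewrite S_INR, <- Rplus_assoc, Gamma_plus1, IH by (apply gamma_dom_plus_INR, Hx).
  simpl; ring.
Qed.

Lemma pochhammer_rf x k : gamma_dom x -> pochhammer x k = rf x k.
Proof.
  intros Hx; unfold pochhammer; rewrite Gamma_rf by exact Hx.
  field; apply Gamma_neq0, Hx.
Qed.

Lemma ex_derive_Gamma x : gamma_dom x -> ex_derive Gamma x.
Proof.
  intros Hx.
  destruct (exists_plus_INR_pos x) as [m Hm]; revert x Hx Hm; induction m as [|m IH]; intros x Hx Hm.
  - simpl in Hm; rewrite Rplus_0_r in Hm.
    apply ex_derive_ext_loc with (fun y => exp (Series (gamma_term y)) / y).
    + exists (mkposreal x Hm); intros y Hy; symmetry; apply Gamma_unique, gamma_seq_lim_pos.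
      apply Rabs_lt_between in Hy; unfold minus, plus, opp in Hy; simpl in Hy; lra.
    + pose proof (is_derive_Series_gamma_term x Hm) as D.
      apply ex_derive_div; [|apply ex_derive_id|lra].
      apply (ex_derive_comp exp (fun y => Series (gamma_term y))); [|eexists; exact D].
      eexists; apply is_derive_exp.
  - rewrite S_INR in Hm.
    pose proof (gamma_dom_neq0 x Hx) as H0.
    apply ex_derive_ext_loc with (fun y => Gamma (y + 1) / y).
    + apply filter_imp with (2 := gamma_dom_locally x Hx); intros y Hy.
      change (Gamma (y + 1) / y = Gamma y :> R).
      rewrite Gamma_plus1 by exact Hy; field; apply gamma_dom_neq0, Hy.
    + apply ex_derive_div; [|apply ex_derive_id|exact H0].
      apply (ex_derive_comp Gamma (fun y => y + 1)); [|auto_derive; trivial].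
      apply IH; [apply gamma_dom_plus1, Hx|lra].
Qed.

(** * The sine product and the reflection formulas *)

Definition cos_int (n : nat) (x : R) : R := RInt (fun t => cos t ^ n * cos (2 * x * t)) 0 (PI / 2).

Lemma continuous_cos_int n x t : continuous (fun t => cos t ^ n * cos (2 * x * t)) t.
Proof. apply (ex_derive_continuous (V := R_NormedModule)); auto_derive; trivial. Qed.

Lemma is_RInt_cos_int n x :
  is_RInt (fun t => cos t ^ n * cos (2 * x * t)) 0 (PI / 2) (cos_int n x).
Proof.
  apply (RInt_correct (V := R_CompleteNormedModule)), (ex_RInt_continuous (V := R_CompleteNormedModule)).
  intros t _; apply continuous_cos_int.
Qed.

Lemma cos_int_rec n x :
  (INR (S (S n)) ^ 2 - 4 * x ^ 2) * cos_int (S (S n)) x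
  = INR (S (S n)) * INR (S n) * cos_int n x.
Proof.
  set (N := INR (S (S n))).
  assert (EN : INR (S n) = N - 1) by (unfold N; rewrite (S_INR (S n)); ring).
  assert (EN' : INR n = N - 2) by (unfold N; rewrite !S_INR; ring).
  (* [f] is a primitive of [df] vanishing at both ends of the interval. *)
  set (f := fun t => cos t ^ S n * (N * sin t * cos (2 * x * t) - 2 * x * cos t * sin (2 * x * t))).
  set (df := fun t => (N ^ 2 - 4 * x ^ 2) * (cos t ^ S (S n) * cos (2 * x * t))
                      - N * (N - 1) * (cos t ^ n * cos (2 * x * t))).
  assert (H : is_RInt df 0 (PI / 2) (minus (f (PI / 2)) (f 0))).
  { apply (is_RInt_derive (V := R_CompleteNormedModule)).
    - intros t _; unfold f, df; auto_derive; trivial.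
      assert (Hs : sin t * sin t = 1 - cos t * cos t).
      { pose proof (sin2_cos2 t); unfold Rsqr in *; lra. }
      change (match n with O => 1 | S _ => INR n + 1 end) with (INR (S n)); rewrite EN.
      simpl pow. simpl Init.Nat.pred.
      set (c := cos t) in *; set (s := sin t) in *; set (p := c ^ n).
      set (C2 := cos (2 * x * t)); set (S2 := sin (2 * x * t)).
      transitivity (p * C2 * (- N * (N - 1) * (s * s) + N * c * c - 4 * x * x * c * c)); [ring|].
      rewrite Hs; ring.
    - intros t _; apply (ex_derive_continuous (V := R_NormedModule)); unfold df; auto_derive; trivial. }
  assert (E0 : minus (f (PI / 2)) (f 0) = 0 :> R).
  { unfold f, minus, plus, opp; simpl.
    rewrite cos_PI2, sin_0, Rmult_0_r, sin_0; ring. }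
  rewrite E0 in H.
  assert (H' : is_RInt df 0 (PI / 2)
     (minus (scal (N ^ 2 - 4 * x ^ 2) (cos_int (S (S n)) x)) (scal (N * (N - 1)) (cos_int n x)))).
  { apply (is_RInt_minus (V := R_NormedModule)
      (fun t => scal (N ^ 2 - 4 * x ^ 2) (cos t ^ S (S n) * cos (2 * x * t)))
      (fun t => scal (N * (N - 1)) (cos t ^ n * cos (2 * x * t))));
      apply (is_RInt_scal (V := R_NormedModule)), is_RInt_cos_int. }
  pose proof (is_RInt_unique (V := R_CompleteNormedModule) _ _ _ _ H) as U.
  rewrite (is_RInt_unique (V := R_CompleteNormedModule) _ _ _ _ H') in U.
  unfold minus, plus, opp, scal in U; simpl in U; unfold mult in U; simpl in U.
  rewrite EN; simpl; lra.
Qed.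

Lemma cos_int_0_pos n : 0 < cos_int n 0.
Proof.
  pose proof PI_RGT_0; apply RInt_gt_0; [lra| |intros; apply continuous_cos_int].
  intros t Ht; rewrite Rmult_0_r, Rmult_0_l, cos_0, Rmult_1_r.
  apply pow_lt, cos_gt_0; lra.
Qed.

Lemma cos_int_0_r x : x <> 0 -> cos_int 0 x = sin (PI * x) / (2 * x).
Proof.
  intros Hx; unfold cos_int.
  rewrite (is_RInt_unique (V := R_CompleteNormedModule) _ _ _
     (minus (sin (2 * x * (PI / 2)) / (2 * x)) (sin (2 * x * 0) / (2 * x)))).
  - unfold minus, plus, opp; simpl.
    rewrite Rmult_0_r, sin_0; replace (2 * x * (PI / 2)) with (PI * x) by field.
    field; exact Hx.
  - apply (is_RInt_derive (V := R_CompleteNormedModule) (fun t => sin (2 * x * t) / (2 * x))).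
    + intros t _; auto_derive; [trivial|]; simpl; field; exact Hx.
    + intros t _; apply continuous_cos_int.
Qed.

Lemma cos_int_0_0 : cos_int 0 0 = PI / 2.
Proof.
  unfold cos_int.
  rewrite (RInt_ext (V := R_CompleteNormedModule) _ (fun _ => 1)).
  - rewrite RInt_const; unfold scal; simpl; unfold mult; simpl; ring.
  - intros t _; rewrite Rmult_0_r, Rmult_0_l, cos_0; simpl; ring.
Qed.

Lemma mult_cos_le_sin t : 0 <= t <= PI / 2 -> t * cos t <= sin t.
Proof.
  intros Ht; pose proof PI_RGT_0.
  destruct (MVT_gen (fun u => sin u - u * cos u) 0 t (fun u => u * sin u)) as (c & Hc & E).
  - intros u _; auto_derive; trivial; ring.
  - intros u _; apply derivable_continuous_pt, ex_derive_Reals_0; auto_derive; trivial.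
  - rewrite Rmin_left, Rmax_right in Hc by lra.
    rewrite sin_0 in E.
    assert (0 <= sin c) by (apply sin_ge_0; lra).
    assert (0 <= c * sin c * (t - 0)) by (repeat apply Rmult_le_pos; lra).
    lra.
Qed.

Lemma sin_sq_le y : sin y ^ 2 <= y ^ 2.
Proof.
  assert (H : forall u, 0 <= u -> sin u ^ 2 <= u ^ 2).
  { intros u Hu; destruct (Rle_lt_dec u 1) as [L|G].
    - pose proof PI2_1; pose proof PI_RGT_0.
      assert (0 <= sin u) by (apply sin_ge_0; lra).
      assert (sin u <= u).
      { destruct (Req_dec u 0) as [->|N]; [rewrite sin_0; lra|]. left; apply sin_lt_x; lra. }
      apply pow_incr; lra.
    - pose proof (SIN_bound u); nra. }
  destruct (Rle_lt_dec 0 y) as [L|G]; [auto|].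
  specialize (H (- y) ltac:(lra)); rewrite sin_neg in H; nra.
Qed.

(* Pointwise, 1 - cos(2xt) <= 2 x^2 t^2 and t cos t <= sin t. *)
Lemma cos_int_diff n x :
  Rabs (cos_int (S (S n)) 0 - cos_int (S (S n)) x)
  <= 2 * x ^ 2 * (cos_int n 0 - cos_int (S (S n)) 0).
Proof.
  pose proof PI_RGT_0.
  assert (H1 : is_RInt (fun t => cos t ^ S (S n) * cos (2 * 0 * t)
       - cos t ^ S (S n) * cos (2 * x * t)) 0 (PI / 2)
       (cos_int (S (S n)) 0 - cos_int (S (S n)) x)).
  { apply (is_RInt_minus (V := R_NormedModule)); apply is_RInt_cos_int. }
  assert (H2 : is_RInt (fun t => 2 * x ^ 2 * (cos t ^ n * cos (2 * 0 * t)
       - cos t ^ S (S n) * cos (2 * 0 * t))) 0 (PI / 2)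
       (2 * x ^ 2 * (cos_int n 0 - cos_int (S (S n)) 0))).
  { apply (is_RInt_scal (V := R_NormedModule) (fun t => cos t ^ n * cos (2 * 0 * t)
       - cos t ^ S (S n) * cos (2 * 0 * t))).
    apply (is_RInt_minus (V := R_NormedModule)); apply is_RInt_cos_int. }
  assert (K : forall t, 0 < t < PI / 2 ->
    0 <= cos t ^ S (S n) * cos (2 * 0 * t) - cos t ^ S (S n) * cos (2 * x * t)
      <= 2 * x ^ 2 * (cos t ^ n * cos (2 * 0 * t) - cos t ^ S (S n) * cos (2 * 0 * t))).
  { intros t Ht; rewrite Rmult_0_r, Rmult_0_l, cos_0.
    replace (2 * x * t) with (2 * (x * t)) by ring; rewrite cos_2a_sin.
    assert (Hc : 0 < cos t) by (apply cos_gt_0; lra).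
    assert (Hp : 0 < cos t ^ n) by (apply pow_lt, Hc).
    pose proof (mult_cos_le_sin t ltac:(lra)) as Ts.
    pose proof (sin_sq_le (x * t)) as Sx.
    pose proof (sin2_cos2 t) as P; unfold Rsqr in P.
    assert (Hcc : 0 < cos t * cos t) by nra.
    assert (Q : (t * cos t) * (t * cos t) <= sin t * sin t) by (apply Rmult_le_compat; nra).
    replace (cos t ^ S (S n) * 1 - cos t ^ S (S n) * (1 - 2 * sin (x * t) * sin (x * t)))
      with (cos t ^ n * (2 * (cos t * cos t * sin (x * t) ^ 2))) by (simpl; ring).
    replace (2 * x ^ 2 * (cos t ^ n * 1 - cos t ^ S (S n) * 1))
      with (cos t ^ n * (2 * (x ^ 2 * (sin t * sin t)))).
    2:{ replace (sin t * sin t) with (1 - cos t * cos t) by lra. simpl; ring. }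
    pose proof (pow2_ge_0 (sin (x * t))); pose proof (pow2_ge_0 x).
    split.
    - apply Rmult_le_pos; [lra|]. nra.
    - apply Rmult_le_compat_l; [lra|]. apply Rmult_le_compat_l; [lra|].
      apply Rle_trans with (cos t * cos t * (x * t) ^ 2); [apply Rmult_le_compat_l; lra|].
      replace (cos t * cos t * (x * t) ^ 2) with (x ^ 2 * ((t * cos t) * (t * cos t))) by ring.
      apply Rmult_le_compat_l; lra. }
  rewrite <- (is_RInt_unique (V := R_CompleteNormedModule) _ _ _ _ H1),
          <- (is_RInt_unique (V := R_CompleteNormedModule) _ _ _ _ H2).
  rewrite Rabs_pos_eq.
  - apply RInt_le; [lra|eexists; exact H1|eexists; exact H2|].
    intros t Ht; apply K, Ht.
  - apply RInt_ge_0; [lra|eexists; exact H1|]. intros t Ht; apply K, Ht.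
Qed.

Fixpoint sine_prod (x : R) (n : nat) : R :=
  match n with O => 1 | S m => sine_prod x m * (1 - x ^ 2 / INR (S m) ^ 2) end.

(** Dividing [cos_int_rec] at x by its instance at 0 shows that each step of the ratio of integrals
    compensates exactly one factor 1 - x^2/N^2. The left side is therefore independent of n, and n =
    0 gives its value. *)
Lemma sine_prod_cos_int x n : x <> 0 ->
  sine_prod x n * (cos_int (2 * n) x / cos_int (2 * n) 0) = sin (PI * x) / (PI * x).
Proof.
  intros Hx; pose proof PI_RGT_0; induction n as [|n IH].
  - simpl; rewrite cos_int_0_r, cos_int_0_0 by exact Hx; field; lra.
  - rewrite <- IH; replace (2 * S n)%nat with (S (S (2 * n))) by lia.
    pose proof (cos_int_0_pos (2 * n)) as P0.
    pose proof (cos_int_0_pos (S (S (2 * n)))) as P1.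
    pose proof (cos_int_rec (2 * n) x) as R1; pose proof (cos_int_rec (2 * n) 0) as R2.
    assert (E : INR (S (S (2 * n))) = 2 * INR (S n))
      by (rewrite !S_INR, mult_INR; simpl; ring).
    rewrite E in R1, R2; pose proof (INR_S_ge1 n) as HN.
    change (sine_prod x (S n)) with (sine_prod x n * (1 - x ^ 2 / INR (S n) ^ 2)).
    set (N := INR (S n)) in *; set (M := INR (S (2 * n))) in *.
    assert (HM : 0 < M) by (apply lt_0_INR; lia).
    set (A1 := cos_int (S (S (2 * n))) x) in *; set (A0 := cos_int (S (S (2 * n))) 0) in *.
    set (B1 := cos_int (2 * n) x) in *; set (B0 := cos_int (2 * n) 0) in *.
    replace B1 with (((2 * N) ^ 2 - 4 * x ^ 2) * A1 / (2 * N * M)) by (rewrite R1; field; lra).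
    replace B0 with (((2 * N) ^ 2) * A0 / (2 * N * M)).
    2:{ apply Rmult_eq_reg_l with (2 * N * M); [|nra]. rewrite <- R2; field; lra. }
    field; lra.
Qed.

Lemma sin_PI_neq0 x : noninteger x -> sin (PI * x) <> 0.
Proof.
  intros Hn E; pose proof PI_RGT_0; apply sin_eq_0_0 in E; destruct E as [k E]; apply (Hn k).
  apply Rmult_eq_reg_l with PI; lra.
Qed.

Lemma is_lim_seq_sine_prod x : noninteger x ->
  is_lim_seq (sine_prod x) (sin (PI * x) / (PI * x)).
Proof.
  intros Hn; pose proof (noninteger_neq0 x Hn) as Hx.
  assert (L : is_lim_seq (fun n => cos_int (2 * n) x / cos_int (2 * n) 0) 1).
  { apply is_lim_seq_incr_1.
    apply is_lim_seq_ext with (fun n => 1 -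
       (cos_int (2 * S n) 0 - cos_int (2 * S n) x) / cos_int (2 * S n) 0).
    { intros n; field; apply Rgt_not_eq, cos_int_0_pos. }
    replace (Finite 1) with (Finite (1 - 0)) by (f_equal; ring).
    apply is_lim_seq_minus'; [apply is_lim_seq_const|].
    apply is_lim_seq_abs_0.
    apply is_lim_seq_le_le with (fun _ => 0) (fun n => 2 * x ^ 2 * / INR (S n)).
    - intros n; split; [apply Rabs_pos|].
      replace (2 * S n)%nat with (S (S (2 * n))) by lia.
      pose proof (cos_int_0_pos (S (S (2 * n)))) as P.
      pose proof (cos_int_diff (2 * n) x) as D.
      pose proof (cos_int_rec (2 * n) 0) as R.
      unfold Rdiv; rewrite Rabs_mult, Rabs_inv, (Rabs_pos_eq (cos_int _ 0)) by lra.
      apply Rmult_le_reg_r with (cos_int (S (S (2 * n))) 0); [exact P|].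
      rewrite Rmult_assoc, Rinv_l, Rmult_1_r by lra.
      eapply Rle_trans; [exact D|].
      assert (HM : INR (S (2 * n)) = 2 * INR (S n) - 1)
        by (rewrite !S_INR, mult_INR; simpl; ring).
      rewrite (S_INR (S (2 * n))), HM in R. pose proof (INR_S_ge1 n) as HN.
      set (N := INR (S n)) in *; set (A := cos_int (S (S (2 * n))) 0) in *.
      (* The recurrence at 0 gives the ratio 2N/(2N - 1) of consecutive even integrals, so their
         relative difference is 1/(2N - 1), at most 1/N. *)
      assert (EB : cos_int (2 * n) 0 = 2 * N * A / (2 * N - 1)).
      { apply Rmult_eq_reg_l with ((2 * N - 1 + 1) * (2 * N - 1)); [rewrite <- R; field; lra|nra]. }
      replace (cos_int (2 * n) 0 - A) with (A * / (2 * N - 1)) by (rewrite EB; field; lra).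
      assert (/ (2 * N - 1) <= / N) by (apply Rinv_le_contravar; lra).
      pose proof (pow2_ge_0 x).
      replace (2 * x ^ 2 * / N * A) with (2 * x ^ 2 * (A * / N)) by ring.
      apply Rmult_le_compat_l; [nra|apply Rmult_le_compat_l; lra].
    - apply is_lim_seq_const.
    - replace (Finite 0) with (Rbar_mult (2 * x ^ 2) 0) by (simpl; f_equal; ring).
      apply is_lim_seq_scal_l, is_lim_seq_inv_INR. }
  (* The limit is taken after dividing by the ratio of integrals; that ratio is nonzero because its
     product with [sine_prod] is. *)
  assert (Hs : sin (PI * x) / (PI * x) <> 0).
  { pose proof PI_RGT_0; apply Rmult_integral_contrapositive_currified.
    - apply sin_PI_neq0, Hn.
    - apply Rinv_neq_0_compat; apply Rmult_integral_contrapositive_currified; lra. }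
  apply is_lim_seq_ext with
    (fun n => (sin (PI * x) / (PI * x)) * / (cos_int (2 * n) x / cos_int (2 * n) 0)).
  { intros n; pose proof (sine_prod_cos_int x n Hx) as E; rewrite <- E in Hs |- *.
    field; split; [apply Rgt_not_eq, cos_int_0_pos|].
    intros Z; apply Hs; rewrite Z; unfold Rdiv; ring. }
  set (s := sin (PI * x) / (PI * x)).
  replace (Finite s) with (Finite (s * / 1)) by (f_equal; field).
  apply (is_lim_seq_scal_l _ _ (Finite (/ 1))).
  apply (is_lim_seq_inv _ (Finite 1)); [exact L|]. intros E; injection E; lra.
Qed.

(** Reflection is exact at finite n: the powers of n cancel, and pairing (x + j) with (-x + j) gives
    j^2 (1 - x^2/j^2), the factor j = 0 contributing -x^2. *)
Lemma gamma_seq_reflection x n : noninteger x ->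
  gamma_seq x (S n) * gamma_seq (- x) (S n) * sine_prod x (S n) = - / x ^ 2.
Proof.
  intros Hn; pose proof (noninteger_neq0 x Hn) as Hx; unfold gamma_seq.
  assert (HN : 0 < INR (S n)) by (apply lt_0_INR; lia).
  assert (P1 : prod_f_R0 (fun j => x + INR j) (S n) <> 0).
  { apply prod_f_R0_neq0; intros j; apply noninteger_plus_INR_neq0, Hn. }
  assert (P2 : prod_f_R0 (fun j => - x + INR j) (S n) <> 0).
  { apply prod_f_R0_neq0; intros j; apply noninteger_plus_INR_neq0, noninteger_opp, Hn. }
  assert (E : forall m, INR (fact m) ^ 2 * sine_prod x m * - x ^ 2
     = prod_f_R0 (fun j => x + INR j) m * prod_f_R0 (fun j => - x + INR j) m).
  { induction m as [|m IH]; [simpl; ring|].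
    rewrite fact_simpl, mult_INR.
    change (sine_prod x (S m)) with (sine_prod x m * (1 - x ^ 2 / INR (S m) ^ 2)).
    change (prod_f_R0 (fun j => x + INR j) (S m))
      with (prod_f_R0 (fun j => x + INR j) m * (x + INR (S m))).
    change (prod_f_R0 (fun j => - x + INR j) (S m))
      with (prod_f_R0 (fun j => - x + INR j) m * (- x + INR (S m))).
    transitivity (prod_f_R0 (fun j => x + INR j) m * prod_f_R0 (fun j => - x + INR j) m
      * ((x + INR (S m)) * (- x + INR (S m)))); [|ring].
    rewrite <- IH; pose proof (INR_S_ge1 m); field; lra. }
  assert (ER : Rpower (INR (S n)) x * Rpower (INR (S n)) (- x) = 1).
  { rewrite <- Rpower_plus, Rplus_opp_r, Rpower_O by exact HN; reflexivity. }
  transitivity (INR (fact (S n)) ^ 2 * sine_prod x (S n)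
    * (Rpower (INR (S n)) x * Rpower (INR (S n)) (- x))
    / (prod_f_R0 (fun j => x + INR j) (S n) * prod_f_R0 (fun j => - x + INR j) (S n))).
  { field; tauto. }
  rewrite ER, <- E.
  assert (P3 : prod_f_R0 (fun j => x + INR j) (S n) * prod_f_R0 (fun j => - x + INR j) (S n) <> 0)
    by (apply Rmult_integral_contrapositive_currified; assumption).
  rewrite <- E in P3.
  field; repeat split; try assumption; intros Z; apply P3; rewrite Z; ring.
Qed.

Lemma Gamma_reflection x : noninteger x ->
  Gamma x * Gamma (- x) * (x * sin (PI * x)) = - PI.
Proof.
  intros Hn; pose proof (noninteger_neq0 x Hn) as Hx; pose proof PI_RGT_0 as HPI.
  assert (L : is_lim_seq (fun n => gamma_seq x n * gamma_seq (- x) n * sine_prod x n)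
     (Gamma x * Gamma (- x) * (sin (PI * x) / (PI * x)))).
  { apply is_lim_seq_mult'; [apply is_lim_seq_mult'|apply is_lim_seq_sine_prod, Hn];
      apply Gamma_correct; right; [|apply noninteger_opp]; exact Hn. }
  apply is_lim_seq_incr_1 in L.
  apply is_lim_seq_ext with (v := fun _ => - / x ^ 2) in L.
  2:{ intros n; apply gamma_seq_reflection, Hn. }
  apply is_lim_seq_unique in L; rewrite Lim_seq_const in L; injection L; intros E.
  transitivity (PI * x ^ 2 * (Gamma x * Gamma (- x) * (sin (PI * x) / (PI * x)))).
  { field; lra. }
  rewrite <- E; field; exact Hx.
Qed.

Lemma is_derive_Gamma x : gamma_dom x -> is_derive Gamma x (digamma x * Gamma x).
Proof.
  intros H; replace (digamma x * Gamma x) with (Derive Gamma x).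
  - apply Derive_correct, ex_derive_Gamma, H.
  - unfold digamma; field; apply Gamma_neq0, H.
Qed.

Lemma digamma_plus1 x : gamma_dom x -> digamma (x + 1) = digamma x + / x.
Proof.
  intros H.
  assert (D1 : is_derive (fun y => Gamma (y + 1)) x (digamma (x + 1) * Gamma (x + 1))).
  { evar_last; [apply (is_derive_comp Gamma (fun y => y + 1));
       [apply is_derive_Gamma, gamma_dom_plus1, H|auto_derive; [trivial|reflexivity]]|].
    unfold scal; simpl; unfold mult; simpl; ring. }
  assert (D2 : is_derive (fun y => Gamma (y + 1)) x (Gamma x + x * (digamma x * Gamma x))).
  { apply is_derive_ext_loc with (fun y => y * Gamma y).
    - apply filter_imp with (2 := gamma_dom_locally x H); intros y Hy.
      symmetry; apply Gamma_plus1, Hy.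
    - evar_last; [apply (is_derive_mult (fun y => y) Gamma);
         [apply is_derive_id|apply is_derive_Gamma, H|intros; apply Rmult_comm]|].
      unfold plus, mult, one; simpl; ring. }
  apply is_derive_unique in D1; apply is_derive_unique in D2; rewrite D1 in D2.
  rewrite Gamma_plus1 in D2 by exact H.
  pose proof (gamma_dom_neq0 x H); pose proof (Gamma_neq0 x H).
  apply Rmult_eq_reg_r with (x * Gamma x).
  - rewrite D2; field; assumption.
  - apply Rmult_integral_contrapositive_currified; assumption.
Qed.

(** By [Gamma_reflection] a product is constant near x, so its logarithmic derivative vanishes. *)
Lemma digamma_reflection x : noninteger x ->
  digamma (- x) = digamma x + / x + PI * cot (PI * x).
Proof.
  intros H.
  pose proof (sin_PI_neq0 x H) as Hs; pose proof (noninteger_neq0 x H) as Hx.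
  pose proof (Gamma_neq0 x (or_intror H)) as G1.
  pose proof (Gamma_neq0 (- x) (or_intror (noninteger_opp x H))) as G2.
  assert (D1 : is_derive (fun y => Gamma (- y)) x (- (digamma (- x) * Gamma (- x)))).
  { evar_last; [apply (is_derive_comp Gamma (fun y => - y));
       [apply is_derive_Gamma; right; apply noninteger_opp, H|auto_derive; [trivial|reflexivity]]|].
    unfold scal; simpl; unfold mult; simpl; ring. }
  assert (D2 : is_derive (fun y => y * sin (PI * y)) x (sin (PI * x) + x * (PI * cos (PI * x)))).
  { auto_derive; [trivial|ring]. }
  assert (D3 := is_derive_mult _ _ _ _ _ (is_derive_mult _ _ _ _ _
      (is_derive_Gamma x (or_intror H)) D1 Rmult_comm) D2 Rmult_comm).
  assert (D4 : is_derive (fun y => Gamma y * Gamma (- y) * (y * sin (PI * y))) x 0).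
  { apply is_derive_ext_loc with (fun _ => - PI); [|apply (is_derive_const (V := R_NormedModule))].
    destruct (noninteger_locally x H) as (d & B & [Hd _] & _ & Hn).
    exists (mkposreal d Hd); intros y Hy; symmetry; apply Gamma_reflection.
    replace y with (x + (y - x)) by ring; apply Hn, Hy. }
  assert (D5 : is_derive (fun y => Gamma y * Gamma (- y) * (y * sin (PI * y))) x
    ((digamma x * Gamma x * Gamma (- x) + Gamma x * - (digamma (- x) * Gamma (- x)))
       * (x * sin (PI * x))
     + Gamma x * Gamma (- x) * (sin (PI * x) + x * (PI * cos (PI * x))))) by exact D3.
  apply is_derive_unique in D5; apply is_derive_unique in D4; rewrite D4 in D5.
  unfold cot.
  apply Rmult_eq_reg_r with (Gamma x * Gamma (- x) * (x * sin (PI * x))).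
  2:{ repeat apply Rmult_integral_contrapositive_currified; assumption. }
  field_simplify; [lra|tauto].
Qed.

(** * Differentiation in the order *)

(** Working by components keeps all differentiation within real calculus; [is_derive_of_Cderive]
    converts the result once, at the end. *)
Definition is_Cderive (f : R -> C) (x : R) (l : C) :=
  is_derive (fun y => Re (f y)) x (Re l) /\ is_derive (fun y => Im (f y)) x (Im l).

Lemma is_derive_of_Cderive f x l : is_Cderive f x l ->
  is_derive (K := R_AbsRing) (V := C_R_NormedModule) f x l.
Proof.
  intros [H1 H2].
  assert (P : filterdiff (U := R_NormedModule) (V := C_R_NormedModule)
    (fun y => (Re (f y), Im (f y))) (locally x) (fun y => (scal y (Re l), scal y (Im l)))).
  { apply (filterdiff_comp'_2 (T := R_NormedModule) (U := R_NormedModule) (V := R_NormedModule)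
      (W := C_R_NormedModule) _ _ (fun a b => (a, b)) x _ _ (fun a b => (a, b)) H1 H2).
    apply filterdiff_ext_locally with (f := fun t : R * R => t).
    - apply filter_forall; intros [a b]; reflexivity.
    - apply (filterdiff_ext_lin _ (fun t : R * R => t)); [apply filterdiff_id|].
      intros [a b]; reflexivity. }
  eapply filterdiff_ext_lin; [eapply filterdiff_ext; [|exact P]|].
  - intros y; simpl; destruct (f y); reflexivity.
  - intros y; simpl; destruct l; reflexivity.
Qed.

Lemma is_Cderive_ext_loc f g x l : locally x (fun y => f y = g y) ->
  is_Cderive f x l -> is_Cderive g x l.
Proof.
  intros H [H1 H2]; split; (eapply is_derive_ext_loc; [|eassumption]);
    apply filter_imp with (2 := H); intros y ->; reflexivity.
Qed.

Lemma is_Cderive_mult f g x df dg : is_Cderive f x df -> is_Cderive g x dg ->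
  is_Cderive (fun y => f y * g y)%C x (df * g x + f x * dg)%C.
Proof.
  intros [H1 H2] [H3 H4]; split.
  - evar_last;
      [apply (is_derive_minus (V := R_NormedModule)); apply (is_derive_mult (K := R_AbsRing));
         eauto using Rmult_comm|].
    unfold minus, plus, opp, mult; simpl; unfold Re, Im; ring.
  - evar_last;
      [apply (is_derive_plus (V := R_NormedModule)); apply (is_derive_mult (K := R_AbsRing));
         eauto using Rmult_comm|].
    unfold minus, plus, opp, mult; simpl; unfold Re, Im; ring.
Qed.

Lemma is_Cderive_minus f g x df dg : is_Cderive f x df -> is_Cderive g x dg ->
  is_Cderive (fun y => f y - g y)%C x (df - dg)%C.
Proof.
  intros [H1 H2] [H3 H4]; split;
    apply (is_derive_minus (V := R_NormedModule)); assumption.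
Qed.

Lemma is_Cderive_RtoC (f : R -> R) (x l : R) : is_derive f x l -> is_Cderive (fun y => RtoC (f y)) x (RtoC l).
Proof. intros H; split; [exact H|]; apply (is_derive_const (V := R_NormedModule) 0). Qed.

Lemma is_Cderive_opp_arg f x l : is_Cderive f (- x) l -> is_Cderive (fun y => f (- y)) x (- l)%C.
Proof.
  intros [H1 H2]; split.
  - evar_last; [apply (is_derive_comp (V := R_NormedModule) (fun y => Re (f y)) (fun y => - y));
      [exact H1|auto_derive; [trivial|reflexivity]]|].
    unfold scal; simpl; unfold mult; simpl; unfold Re; ring.
  - evar_last; [apply (is_derive_comp (V := R_NormedModule) (fun y => Im (f y)) (fun y => - y));
      [exact H2|auto_derive; [trivial|reflexivity]]|].
    unfold scal; simpl; unfold mult; simpl; unfold Im; ring.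
Qed.

Lemma is_Cderive_Crpower z a : is_Cderive (Crpower z) a (Clog z * Crpower z a)%C.
Proof.
  unfold Crpower, Cexp; generalize (Clog z); intros [p q]; split; unfold Re, Im; simpl;
    (auto_derive; [trivial|unfold Rminus; ring]).
Qed.

Lemma Crpower_add z a b : Crpower z (a + b) = (Crpower z a * Crpower z b)%C.
Proof.
  unfold Crpower, Cexp; generalize (Clog z); intros [p q].
  apply C_ext; unfold Re, Im; simpl;
    rewrite !Rmult_0_l, !Rminus_0_r, !Rplus_0_r, !Rmult_plus_distr_r, exp_plus,
      ?cos_plus, ?sin_plus; ring.
Qed.

Lemma Crpower_0 z : Crpower z 0 = RtoC 1.
Proof.
  unfold Crpower, Cexp; generalize (Clog z); intros [p q]; apply C_ext; unfold Re, Im; simpl;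
    rewrite !Rmult_0_l, Rminus_0_r, Rplus_0_r, exp_0, ?cos_0, ?sin_0; ring.
Qed.

Lemma entire_bc mu : noninteger mu -> entire (bc mu).
Proof.
  intros H; destruct (noninteger_locally mu H) as (d & B & [Hd _] & HB & Hn).
  destruct (Hn 0) as [_ H0]; [rewrite Rabs_R0; exact Hd|]; rewrite Rplus_0_r in H0.
  exists 1, B; repeat split; try lra; intros k; rewrite Rmult_1_l.
  apply (bc_dbc_bounds mu 0 B); rewrite ?Rplus_0_r; assumption.
Qed.

Lemma entire_dbc mu : noninteger mu -> entire (dbc mu).
Proof.
  intros H; destruct (noninteger_locally mu H) as (d & B & [Hd _] & HB & Hn).
  destruct (Hn 0) as [_ H0]; [rewrite Rabs_R0; exact Hd|]; rewrite Rplus_0_r in H0.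
  exists 1, (2 * B ^ 2); repeat split; try lra; [nra|]; intros k; rewrite Rmult_1_l.
  apply (bc_dbc_bounds mu 0 B); rewrite ?Rplus_0_r; assumption.
Qed.

Lemma is_Cderive_CPS (a : R -> nat -> R) (a' : nat -> R) x M D d t : 0 < d -> 0 <= M -> 0 <= D ->
  entire (a x) -> entire a' ->
  (forall k h, Rabs h < d ->
     Rabs (a (x + h) k - a x k - h * a' k) <= h ^ 2 * (M * (D ^ k / INR (fact k)))) ->
  is_Cderive (fun y => CPS (a y) t) x (CPS a' t).
Proof.
  intros Hd HM HD Ha Ha' H.
  assert (K : forall p : nat -> R, (forall k, Rabs (p k) <= Cmod t ^ k) ->
    is_derive (fun y => Series (fun k => a y k * p k)) x (Series (fun k => a' k * p k))).
  { intros p Hp.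
    pose proof (Cmod_ge_0 t) as Ht.
    apply (is_derive_Series_quadratic (fun k y => a y k * p k) _
      (fun k => M * ((D * Cmod t) ^ k / INR (fact k))) x d Hd).
    - apply ex_series_Rabs, (entire_ex_series _ (Cmod t)); assumption.
    - apply ex_series_Rabs, (entire_ex_series _ (Cmod t)); assumption.
    - apply ex_series_scal_R, ex_series_exp.
    - intros k h Hh.
      replace (a (x + h) k * p k - a x k * p k - h * (a' k * p k))
        with ((a (x + h) k - a x k - h * a' k) * p k) by ring.
      rewrite Rabs_mult, Rpow_mult_distr.
      replace (h ^ 2 * (M * (D ^ k * Cmod t ^ k / INR (fact k))))
        with (h ^ 2 * (M * (D ^ k / INR (fact k))) * Cmod t ^ k) by (unfold Rdiv; ring).
      apply Rmult_le_compat; auto using Rabs_pos. }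
  split.
  - rewrite CPS_Re; eapply is_derive_ext; [|apply K, Rabs_Re_Cpow].
    intros y; symmetry; apply CPS_Re.
  - rewrite CPS_Im; eapply is_derive_ext; [|apply K, Rabs_Im_Cpow].
    intros y; symmetry; apply CPS_Im.
Qed.

Lemma is_Cderive_CPS_bc mu t : noninteger mu ->
  is_Cderive (fun y => CPS (bc y) t) mu (CPS (dbc mu) t).
Proof.
  intros H; destruct (noninteger_locally mu H) as (d & B & [Hd _] & HB & Hn).
  destruct (Hn 0) as [_ H0]; [rewrite Rabs_R0; exact Hd|]; rewrite Rplus_0_r in H0.
  apply (is_Cderive_CPS bc (dbc mu) mu 1 (3 * B ^ 3) d); try assumption; try lra.
  - assert (0 <= B ^ 3) by (apply pow_le; lra); lra.
  - apply entire_bc, H.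
  - apply entire_dbc, H.
  - intros k h Hh; rewrite Rmult_1_l; destruct (Hn h Hh).
    apply (bc_dbc_bounds mu h B); assumption.
Qed.

(** * Continuity of the 2F3 series in the order *)

(** At a half-integer order the required value is a limit in the order. A Lipschitz bound on the
    coefficients, summable against the powers of t, gives the continuity that identifies this
    limit. *)
Lemma Fc_lipschitz mu : noninteger mu ->
  exists M D d, 0 <= M /\ 0 <= D /\ 0 < d /\ forall h, Rabs h < d ->
    noninteger (mu + h) /\
    forall k, Rabs (Fc (mu + h) k - Fc mu k) <= Rabs h * (M * (D ^ k / INR (fact k))).
Proof.
  intros H; destruct (noninteger_locally mu H) as (d & B & Hd & HB & Hn).
  destruct (Hn 0) as [_ H0]; [rewrite Rabs_R0; lra|]; rewrite Rplus_0_r in H0.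
  set (D := 3 * B ^ 3).
  assert (B1 : 1 <= B ^ 2) by (simpl; nra).
  assert (B2 : B ^ 2 <= B ^ 3) by (simpl in *; nra).
  assert (B3 : B <= B ^ 2) by (simpl; nra).
  (* The first summand pays for the variation of the convolution, the second for that of mu/(mu +
     k). The base doubles because convolving two series with base D gives base D + D. *)
  exists ((Rabs mu + 1) * B * 4 + (B + Rabs mu * B ^ 2)), (D + D), d.
  pose proof (Rabs_pos mu) as Hmu.
  repeat split; [nra|unfold D; lra|lra|apply Hn; assumption|].
  destruct (Hn h H1) as [Hi Hb]; intros k.
  set (E := fun k => 1 * (D ^ k / INR (fact k))).
  set (E2 := fun k => (2 * Rabs h) * (D ^ k / INR (fact k))).
  pose proof (bc_dbc_bounds mu h B HB H Hi H0 Hb) as Bd.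
  assert (D0 : 0 <= D) by (unfold D; lra).
  assert (BD : forall j, B ^ j / INR (fact j) <= E j).
  { intros j; unfold E; rewrite Rmult_1_l; apply pow_fact_le; unfold D; lra. }
  assert (A1 : forall j, Rabs (bc mu j) <= E j)
    by (intros j; eapply Rle_trans; [apply Bd|apply BD]).
  assert (A2 : forall j, Rabs (bc (mu + h) j) <= E j).
  { intros j; eapply Rle_trans; [|apply BD].
    apply (bc_dbc_bounds (mu + h) 0 B); rewrite ?Rplus_0_r; assumption. }
  assert (A3 : forall j, Rabs (fps_sub (bc (mu + h)) (bc mu) j) <= E2 j).
  { intros j; unfold fps_sub, E2; destruct (Bd j) as (_ & b2 & b3).
    replace (bc (mu + h) j - bc mu j)
      with ((bc (mu + h) j - bc mu j - h * dbc mu j) + h * dbc mu j) by ring.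
    eapply Rle_trans; [apply Rabs_triang|]; rewrite Rabs_mult.
    assert (b2' : Rabs (dbc mu j) <= D ^ j / INR (fact j)).
    { eapply Rle_trans; [exact b2|apply pow_fact_le; unfold D; simpl in *; lra]. }
    pose proof (pow_fact_pos D j D0) as PP; pose proof (Rabs_pos h) as Ph.
    fold D in b3; rewrite <- (pow2_abs h) in b3.
    assert (Rabs h ^ 2 <= Rabs h) by nra.
    assert (Rabs h ^ 2 * (D ^ j / INR (fact j)) <= Rabs h * (D ^ j / INR (fact j)))
      by (apply Rmult_le_compat_r; assumption).
    assert (Rabs h * Rabs (dbc mu j) <= Rabs h * (D ^ j / INR (fact j)))
      by (apply Rmult_le_compat_l; assumption).
    lra. }
  set (c' := conv (bc (mu + h)) (bc (mu + h)) k); set (c := conv (bc mu) (bc mu) k).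
  set (X := (D + D) ^ k / INR (fact k)).
  assert (PX : 0 <= X) by (apply pow_fact_pos; lra).
  assert (C1 : Rabs c <= X).
  { unfold c; eapply Rle_trans; [apply conv_abs_le; apply A1|].
    unfold E; rewrite conv_exp; fold X; lra. }
  assert (C2 : Rabs (c' - c) <= 4 * Rabs h * X).
  (* Difference of squares: u'^2 - u^2 = (u' - u) u' + (u' - u) u. *)
  { replace (c' - c) with (conv (fps_sub (bc (mu + h)) (bc mu)) (bc (mu + h)) k
      + conv (fps_sub (bc (mu + h)) (bc mu)) (bc mu) k).
    2:{ change (fps_add (conv (fps_sub (bc (mu + h)) (bc mu)) (bc (mu + h)))
          (conv (fps_sub (bc (mu + h)) (bc mu)) (bc mu)) k
          = fps_sub (conv (bc (mu + h)) (bc (mu + h))) (conv (bc mu) (bc mu)) k).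
        match goal with |- ?f k = ?g k => assert (EQ : f = g) by ring; rewrite EQ; reflexivity end. }
    eapply Rle_trans; [apply Rabs_triang|].
    assert (Rabs (conv (fps_sub (bc (mu + h)) (bc mu)) (bc (mu + h)) k) <= 2 * Rabs h * X).
    { eapply Rle_trans; [apply conv_abs_le; [apply A3|apply A2]|].
      unfold E, E2; rewrite conv_exp; fold X; lra. }
    assert (Rabs (conv (fps_sub (bc (mu + h)) (bc mu)) (bc mu) k) <= 2 * Rabs h * X).
    { eapply Rle_trans; [apply conv_abs_le; [apply A3|apply A1]|].
      unfold E, E2; rewrite conv_exp; fold X; lra. }
    lra. }
  pose proof (noninteger_plus_INR_neq0 mu k H) as N1.
  pose proof (noninteger_plus_INR_neq0 (mu + h) k Hi) as N2.
  assert (Y1 : Rabs (/ (mu + INR k)) <= B).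
  { specialize (H0 (- Z.of_nat k)%Z); rewrite opp_IZR, <- INR_IZR_INZ in H0.
    replace (mu + INR k) with (mu - - INR k) by ring; exact H0. }
  assert (Y2 : Rabs (/ (mu + h + INR k)) <= B).
  { specialize (Hb (- Z.of_nat k)%Z); rewrite opp_IZR, <- INR_IZR_INZ in Hb.
    replace (mu + h + INR k) with (mu + h - - INR k) by ring; exact Hb. }
  unfold Fc; fold c c'.
  replace ((mu + h) / (mu + h + INR k) * c' - mu / (mu + INR k) * c)
    with ((mu + h) * / (mu + h + INR k) * (c' - c)
          + h * (/ (mu + h + INR k) - mu * (/ (mu + INR k) * / (mu + h + INR k))) * c)
    by (field; split; assumption).
  eapply Rle_trans; [apply Rabs_triang|].
  rewrite !Rabs_mult.
  assert (T1 : Rabs (mu + h) <= Rabs mu + 1)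
    by (eapply Rle_trans; [apply Rabs_triang|lra]).
  assert (T2 : Rabs (mu + h) * Rabs (/ (mu + h + INR k)) * Rabs (c' - c)
    <= (Rabs mu + 1) * B * (4 * Rabs h * X)).
  { repeat apply Rmult_le_compat; auto using Rabs_pos, Rmult_le_pos. }
  assert (T3 : Rabs (/ (mu + h + INR k) - mu * (/ (mu + INR k) * / (mu + h + INR k)))
     <= B + Rabs mu * B ^ 2).
  { eapply Rle_trans; [apply Rabs_triang|]; rewrite Rabs_Ropp, !Rabs_mult.
    apply Rplus_le_compat; [exact Y2|].
    apply Rmult_le_compat_l; [exact Hmu|].
    replace (B ^ 2) with (B * B) by ring.
    apply Rmult_le_compat; auto using Rabs_pos. }
  assert (T4 : Rabs h * Rabs (/ (mu + h + INR k) - mu * (/ (mu + INR k) * / (mu + h + INR k)))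
      * Rabs c <= Rabs h * (B + Rabs mu * B ^ 2) * X).
  { repeat apply Rmult_le_compat; auto using Rabs_pos, Rmult_le_pos; lra. }
  fold X; lra.
Qed.

Lemma entire_Fc mu : noninteger mu -> entire (Fc mu).
Proof.
  intros H; destruct (noninteger_locally mu H) as (d & B & [Hd _] & HB & Hn).
  destruct (Hn 0) as [_ H0]; [rewrite Rabs_R0; exact Hd|]; rewrite Rplus_0_r in H0.
  apply (entire_le (conv (bc mu) (bc mu)) _ (Rabs mu * B)).
  - apply Rmult_le_pos; [apply Rabs_pos|lra].
  - intros k; unfold Fc, Rdiv; rewrite !Rabs_mult; apply Rmult_le_compat_r; [apply Rabs_pos|].
    apply Rmult_le_compat_l; [apply Rabs_pos|].
    specialize (H0 (- Z.of_nat k)%Z); rewrite opp_IZR, <- INR_IZR_INZ in H0.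
    replace (mu + INR k) with (mu - - INR k) by ring; exact H0.
  - apply entire_conv; apply entire_bc, H.
Qed.

Lemma entire_Gc mu : noninteger mu -> entire (Gc mu).
Proof.
  intros H; apply (entire_le (conv (bc mu) (bc (- mu))) _ 1); [lra| |].
  - intros [|k]; [unfold Gc; rewrite Rabs_R0, Rmult_1_l; apply Rabs_pos|].
    unfold Gc, Rdiv; rewrite Rabs_mult, Rmult_comm; apply Rmult_le_compat_r; [apply Rabs_pos|].
    pose proof (INR_S_ge1 k).
    rewrite Rabs_pos_eq by (left; apply Rinv_0_lt_compat; lra).
    rewrite <- Rinv_1; apply Rinv_le_contravar; lra.
  - apply entire_conv; apply entire_bc; [|apply noninteger_opp]; exact H.
Qed.

Lemma CPS_Fc_continuous mu t : noninteger mu ->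
  filterlim (fun y => CPS (Fc y) t) (locally mu) (locally (T := C_UniformSpace) (CPS (Fc mu) t)).
Proof.
  intros H; destruct (Fc_lipschitz mu H) as (M & D & d & HM & HD & Hd & L).
  pose proof (Cmod_ge_0 t) as Ht.
  set (m := fun k => M * ((D * Cmod t) ^ k / INR (fact k))).
  assert (Em : ex_series m) by (apply ex_series_scal_R, ex_series_exp).
  assert (K : forall (p : nat -> R) h, (forall k, Rabs (p k) <= Cmod t ^ k) -> Rabs h < d ->
    Rabs (Series (fun k => Fc (mu + h) k * p k) - Series (fun k => Fc mu k * p k))
      <= Rabs h * Series m).
  { intros p h Hp Hh; destruct (L h Hh) as [Hi Lh].
    rewrite <- Series_minus, <- Series_scal_l
      by (apply ex_series_Rabs, (entire_ex_series _ (Cmod t)); auto using entire_Fc).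
    apply Series_le_abs; [|apply ex_series_scal_R, Em].
    intros k; rewrite <- Rmult_minus_distr_r, Rabs_mult; unfold m.
    rewrite Rpow_mult_distr.
    replace (Rabs h * (M * (D ^ k * Cmod t ^ k / INR (fact k))))
      with (Rabs h * (M * (D ^ k / INR (fact k))) * Cmod t ^ k) by (unfold Rdiv; ring).
    apply Rmult_le_compat; auto using Rabs_pos. }
  set (s := Rabs (Series m)).
  assert (Hs : 0 <= s) by apply Rabs_pos.
  apply (filterlim_locally (U := C_UniformSpace)); intros eps.
  assert (Hp : 0 < Rmin d (eps / (s + 1))).
  { apply Rmin_glb_lt; [exact Hd|]; apply Rdiv_lt_0_compat; [apply eps|lra]. }
  exists (mkposreal _ Hp); intros y Hy.
  assert (Hy' : Rabs (y - mu) < Rmin d (eps / (s + 1))) by exact Hy; clear Hy.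
  assert (Q : forall p : nat -> R, (forall k, Rabs (p k) <= Cmod t ^ k) ->
    Rabs (Series (fun k => Fc y k * p k) - Series (fun k => Fc mu k * p k)) < eps).
  { intros p Hpp.
    assert (Y1 : Rabs (y - mu) < d) by (eapply Rlt_le_trans; [exact Hy'|apply Rmin_l]).
    assert (Y2 : Rabs (y - mu) < eps / (s + 1))
      by (eapply Rlt_le_trans; [exact Hy'|apply Rmin_r]).
    specialize (K p (y - mu) Hpp Y1); rewrite Rplus_minus in K.
    eapply Rle_lt_trans; [exact K|].
    apply Rle_lt_trans with (Rabs (y - mu) * (s + 1)).
    - apply Rmult_le_compat_l; [apply Rabs_pos|]. pose proof (Rle_abs (Series m)); unfold s; lra.
    - apply Rmult_lt_compat_r with (r := s + 1) in Y2; [|lra].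
      replace (eps / (s + 1) * (s + 1)) with (pos eps) in Y2 by (field; lra). exact Y2. }
  split.
  - change (Rabs (Re (CPS (Fc y) t) - Re (CPS (Fc mu) t)) < eps).
    rewrite !CPS_Re; apply Q, Rabs_Re_Cpow.
  - change (Rabs (Im (CPS (Fc y) t) - Im (CPS (Fc mu) t)) < eps).
    rewrite !CPS_Im; apply Q, Rabs_Im_Cpow.
Qed.

(** * Bessel and hypergeometric series as power series in (z/2)^2 *)

Lemma CSeries_ext a b : (forall k, a k = b k) -> CSeries a = CSeries b.
Proof. intros H; unfold CSeries; f_equal; apply Series_ext; intros k; rewrite H; reflexivity. Qed.

Lemma RtoC_neq0 x : x <> 0 -> RtoC x <> RtoC 0.
Proof. intros H E; apply H; injection E; trivial. Qed.

Lemma BesselI_CPS mu z : noninteger mu ->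
  BesselI mu z = (Crpower (z / 2) mu * (RtoC (/ Gamma (mu + 1)) * CPS (bc mu) ((z / 2) ^ 2)))%C.
Proof.
  intros H; unfold BesselI; f_equal; rewrite <- CPS_scal; unfold CPS.
  apply CSeries_ext; intros k.
  assert (Hd : gamma_dom (mu + 1)) by (right; apply noninteger_plus1, H).
  rewrite Cpow_mult_r.
  replace (mu + INR k + 1) with (mu + 1 + INR k) by ring.
  rewrite Gamma_rf by exact Hd.
  pose proof (Gamma_neq0 _ Hd) as HG; pose proof (INR_fact_neq_0 k) as Hf.
  pose proof (rf_noninteger_neq0 _ k (noninteger_plus1 _ H)) as Hr.
  replace (/ Gamma (mu + 1) * bc mu k) with (/ (INR (fact k) * (rf (mu + 1) k * Gamma (mu + 1))))
    by (unfold bc; field; tauto).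
  rewrite RtoC_inv; [unfold Cdiv; ring|].
  repeat apply Rmult_integral_contrapositive_currified; assumption.
Qed.

(** The factor 4^k converts the hypergeometric argument z^2 into t = (z/2)^2. *)
Lemma pFq_CPS a b c (z : C) :
  (forall k, pochhammers a k / pochhammers b k * 4 ^ k / INR (fact k) = c k) ->
  pFq a b (z ^ 2)%C = CPS c ((z / 2) ^ 2)%C.
Proof.
  intros H; unfold pFq, CPS; apply CSeries_ext; intros k; rewrite <- H.
  replace (z ^ 2)%C with (RtoC 4 * (z / 2) ^ 2)%C by (simpl; field).
  rewrite Cpow_mult_l. unfold Rdiv at 2. rewrite !RtoC_mult, RtoC_pow.
  rewrite (RtoC_inv (INR (fact k))) by apply INR_fact_neq_0.
  unfold Cdiv; ring.
Qed.

(** The last two hypotheses keep the Pochhammer symbols away from poles of Gamma. They are phrased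
    by [gamma_dom] so as to admit positive half-integers mu, where both parameters are positive
    integers. *)
Lemma F23_CPS mu z : noninteger mu -> gamma_dom (1 / 2 + mu) -> gamma_dom (1 + 2 * mu) ->
  F23 mu z = CPS (Fc mu) ((z / 2) ^ 2)%C.
Proof.
  intros H H1 H2; unfold F23; apply pFq_CPS; intros k; unfold pochhammers; cbn [fold_right].
  rewrite !pochhammer_rf, !Rmult_1_r;
    try assumption; try (right; assumption);
    try (right; rewrite Rplus_comm; apply noninteger_plus1, H).
  symmetry; apply Fc_eq; [exact H|].
  apply rf_neq0; intros j _; apply gamma_dom_neq0, gamma_dom_plus_INR; rewrite Rplus_comm; exact H2.
Qed.

Lemma F34_CPS mu z : noninteger mu ->
  (z ^ 2 / (4 * (1 - mu ^ 2)) * F34 mu z)%C = CPS (Gc mu) ((z / 2) ^ 2)%C.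
Proof.
  intros H.
  assert (Hm : 1 - mu ^ 2 <> 0).
  { intros E; assert (E' : (1 - mu) * (1 + mu) = 0) by (rewrite <- E; ring).
    apply Rmult_integral in E'; destruct E' as [E'|E'];
      [apply (H 1%Z)|apply (H (-1)%Z)]; simpl; lra. }
  assert (HF : F34 mu z = CPS (fun k => (1 - mu ^ 2) * Gc mu (S k)) ((z / 2) ^ 2)%C).
  { unfold F34; apply pFq_CPS; intros k; rewrite Gc_eq by exact H; unfold pochhammers; cbn [fold_right].
    rewrite !pochhammer_rf, !Rmult_1_r; try reflexivity; try (left; lra).
    - right. replace (2 + mu) with (mu + INR 2) by (simpl; ring). apply noninteger_plus_INR, H.
    - right. replace (2 - mu) with (- mu + INR 2) by (simpl; ring).
      apply noninteger_plus_INR, noninteger_opp, H. }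
  rewrite HF, CPS_scal.
  (* The series G starts at t, and this factor t is the z^2/4 in front of the 3F4. *)
  assert (EG : Gc mu = conv fps_X (fun k => Gc mu (S k))).
  { apply functional_extensionality; intros [|k]; [simpl; ring|rewrite conv_X_S; reflexivity]. }
  assert (E1 : entire (fun k => Gc mu (S k))).
  { destruct (entire_Gc mu H) as (M & D & HM & HD & HB).
      exists (M * D), D; repeat split; [apply Rmult_le_pos; assumption|assumption|].
      intros k; eapply Rle_trans; [apply HB|].
      rewrite fact_simpl, mult_INR; pose proof (INR_S_ge1 k); pose proof (INR_fact_lt_0 k).
      replace (M * (D ^ S k / (INR (S k) * INR (fact k))))
        with (M * D * (D ^ k / INR (fact k)) * / INR (S k)) by (simpl pow; field; lra).
      rewrite <- (Rmult_1_r (M * D * _)) at 2.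
      apply Rmult_le_compat_l.
      - apply Rmult_le_pos; [apply Rmult_le_pos; assumption|apply pow_fact_pos, HD].
      - rewrite <- Rinv_1; apply Rinv_le_contravar; lra. }
  transitivity ((z / 2) ^ 2 * CPS (fun k => Gc mu (S k)) ((z / 2) ^ 2))%C.
  2:{ transitivity (CPS (conv fps_X (fun k => Gc mu (S k))) ((z / 2) ^ 2)%C).
      - rewrite CPS_mul, CPS_X by (exact E1 || apply entire_X); reflexivity.
      - rewrite <- EG; reflexivity. }
  set (G := CPS _ _); clearbody G.
  rewrite RtoC_minus, RtoC_pow; unfold Cpow; field.
  intros E; apply (RtoC_neq0 _ Hm); rewrite RtoC_minus, RtoC_pow; rewrite <- E; simpl; ring.
Qed.

Lemma Gc_opp mu : Gc (- mu) = Gc mu.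
Proof.
  apply functional_extensionality; intros [|k]; [reflexivity|]; unfold Gc.
  rewrite Ropp_involutive, conv_comm; reflexivity.
Qed.

Lemma CPS_dbc mu t : noninteger mu ->
  CPS (dbc mu) t
  = (CPS (bc mu) t * (CPS (Gc mu) t + 1 / (2 * mu))
     - CPS (bc (- mu)) t * CPS (Fc mu) t / (2 * mu))%C.
Proof.
  intros H; pose proof (noninteger_neq0 mu H) as H0.
  pose proof (f_equal (fun a => CPS a t) (dbc_eq mu H)) as E; cbv beta in E.
  pose proof (entire_bc mu H) as Eb. pose proof (entire_bc _ (noninteger_opp mu H)) as Eb'.
  pose proof (entire_Gc mu H) as EG. pose proof (entire_Fc mu H) as EF.
  assert (Eq : (bc mu * (fps_const (2 * mu) * Gc mu + fps_const 1) - bc (- mu) * Fc mu)%fps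
    = (bc mu * (fps_const (2 * mu) * Gc mu + fps_const 1)
       + fps_const (-1) * (bc (- mu) * Fc mu))%fps).
  { apply functional_extensionality; intros n; unfold fps_sub, fps_add.
    rewrite (conv_const_l (-1)); ring. }
  rewrite Eq in E.
  rewrite CPS_add, !CPS_mul, CPS_add, CPS_mul, !CPS_const in E;
    auto using entire_add, entire_conv, entire_const, entire_dbc.
  assert (H2 : RtoC (2 * mu) <> RtoC 0) by (apply RtoC_neq0; lra).
  rewrite RtoC_mult in *.
  transitivity (RtoC 2 * RtoC mu * CPS (dbc mu) t / (RtoC 2 * RtoC mu))%C.
  - field; apply RtoC_neq0, H0.
  - rewrite E; change (RtoC (-1)) with (RtoC (- (1))); rewrite RtoC_opp.
    field; apply RtoC_neq0, H0.
Qed.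

(** The term -1/(2 mu) is the sum of -1/mu, from psi(mu + 1) = psi(mu) + 1/mu, and the 1/(2 mu) in
    [CPS_dbc]. *)
Lemma is_Cderive_BesselI mu z : noninteger mu ->
  is_Cderive (fun y => BesselI y z) mu
    (BesselI mu z * (Clog (z / 2) - digamma mu - 1 / (2 * mu) + CPS (Gc mu) ((z / 2) ^ 2))
     - Crpower (z / 2) mu * CPS (bc (- mu)) ((z / 2) ^ 2) * CPS (Fc mu) ((z / 2) ^ 2)
       / (2 * mu * (mu * Gamma mu)))%C.
Proof.
  intros H; pose proof (noninteger_neq0 mu H) as H0.
  pose proof (Gamma_neq0 mu (or_intror H)) as HG.
  apply is_Cderive_ext_loc with
    (fun y => Crpower (z / 2) y * (RtoC (/ Gamma (y + 1)) * CPS (bc y) ((z / 2) ^ 2)))%C.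
  { destruct (noninteger_locally mu H) as (d & B & [Hd _] & _ & Hn).
    exists (mkposreal d Hd); intros y Hy; symmetry; apply BesselI_CPS.
    rewrite <- (Rplus_minus mu y); apply Hn, Hy. }
  assert (Dg : is_derive (fun y => / Gamma (y + 1)) mu (- digamma (mu + 1) / Gamma (mu + 1))).
  { assert (Hd : gamma_dom (mu + 1)) by (right; apply noninteger_plus1, H).
    evar_last; [apply is_derive_inv; [|apply Gamma_neq0, Hd];
       apply (is_derive_comp Gamma (fun y => y + 1));
       [apply is_derive_Gamma, Hd|auto_derive; [trivial|reflexivity]]|].
    unfold scal; simpl; unfold mult; simpl; field; apply Gamma_neq0, Hd. }
  evar_last.
  - apply is_Cderive_mult; [apply is_Cderive_Crpower|].
    apply is_Cderive_mult; [apply is_Cderive_RtoC, Dg|apply is_Cderive_CPS_bc, H].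
  - rewrite BesselI_CPS, CPS_dbc by exact H.
    rewrite digamma_plus1, Gamma_plus1 by (right; exact H).
    unfold Rdiv; rewrite RtoC_mult, RtoC_opp, RtoC_plus, !RtoC_inv, RtoC_mult
      by (try apply Rmult_integral_contrapositive_currified; assumption).
    field; split; apply RtoC_neq0; assumption.
Qed.

(** * Half-integer orders and the final assembly *)

Lemma not_half_integer_noninteger nu : 0 < nu -> noninteger nu ->
  (forall m : nat, nu <> INR m + 1 / 2) -> noninteger (2 * nu).
Proof.
  intros Hp Hn Hm n E.
  destruct (Z.Even_or_Odd n) as [[k Ek]|[k Ek]]; subst n.
  - apply (Hn k); rewrite mult_IZR in E; lra.
  - rewrite plus_IZR, mult_IZR in E.
    assert (Hk : (0 <= k)%Z).
    { destruct (Z.le_gt_cases 0 k) as [L|G]; [exact L|exfalso].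
      assert (IZR k <= -1) by (apply IZR_le; lia). lra. }
    apply (Hm (Z.to_nat k)); rewrite INR_IZR_INZ, Z2Nat.id by exact Hk; lra.
Qed.

Lemma F23_neg_CPS mu z : noninteger mu -> noninteger (2 * mu) ->
  F23 (- mu) z = CPS (Fc (- mu)) ((z / 2) ^ 2)%C.
Proof.
  intros H H2; apply F23_CPS.
  - apply noninteger_opp, H.
  - right; intros n E; apply (H2 (1 - 2 * n)%Z); rewrite minus_IZR, mult_IZR; lra.
  - right; intros n E; apply (H2 (1 - n)%Z); rewrite minus_IZR; lra.
Qed.

Lemma is_F23_neg_CPS nu z : 0 < nu -> noninteger nu ->
  is_F23_neg nu z (CPS (Fc (- nu)) ((z / 2) ^ 2)%C).
Proof.
  intros Hp H; split.
  - intros Hm; symmetry; apply F23_neg_CPS; [exact H|apply not_half_integer_noninteger; assumption].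
  - intros [m Em].
    apply filterlim_ext_loc with (fun mu => CPS (Fc (- mu)) ((z / 2) ^ 2)%C).
    (* Within 1/4 of nu, the number 2y stays within 1/2 of 2 nu = 2m + 1, so it is an integer only
       at y = nu, which the punctured filter excludes. *)
    + assert (Hq : 0 < 1 / 4) by lra.
      exists (mkposreal _ Hq); intros y Hy Hne.
      assert (Hy' : Rabs (y - nu) < 1 / 4) by exact Hy.
      apply Rabs_lt_between in Hy'.
      assert (H2 : noninteger (2 * y)).
      { intros n E; apply Hne.
        rewrite INR_IZR_INZ in Em.
        assert (n = 2 * Z.of_nat m + 1)%Z.
        { assert (n < 2 * Z.of_nat m + 2)%Z
            by (apply lt_IZR; rewrite plus_IZR, mult_IZR; lra).
          assert (2 * Z.of_nat m < n)%Z by (apply lt_IZR; rewrite mult_IZR; lra). lia. }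
        subst n; rewrite plus_IZR, mult_IZR in E; change (y = nu :> R); lra. }
      symmetry; apply F23_neg_CPS; [|exact H2].
      intros n E; apply (H2 (2 * n)%Z); rewrite mult_IZR, E; reflexivity.
    + apply (filterlim_filter_le_1 (F := locally nu)).
      { intros P [eps He]; exists eps; intros y Hy _; apply He, Hy. }
      apply (filterlim_comp _ _ _ (fun mu => - mu) (fun y => CPS (Fc y) ((z / 2) ^ 2)%C)
               _ (locally (- nu))).
      * apply (filterlim_opp (V := R_NormedModule)).
      * apply CPS_Fc_continuous, noninteger_opp, H.
Qed.

Theorem mainTheorem4 (nu : R) (z : C)
  (hnu : 0 < nu) (hnuZ : forall n : Z, nu <> IZR n)
  (hz : z <> RtoC 0) (hargz : Rabs (Carg z) < PI) :
  exists F : C, is_F23_neg nu z F /\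
  is_derive (K := R_AbsRing) (V := C_R_NormedModule)
    (fun mu : R => BesselK mu z) nu
    (PI / 2 * csc (PI * nu) *
       (PI * cot (PI * nu) * BesselI nu z
        - (BesselI nu z + BesselI (- nu) z)
          * (z ^ 2 / (4 * (1 - nu ^ 2)) * F34 nu z
             + Clog (z / 2) - digamma nu - 1 / (2 * nu)))
     + 1 / 4 *
       (BesselI (- nu) z * Gamma (- nu) ^ 2 * Crpower (z / 2) (2 * nu) * F23 nu z
        - BesselI nu z * Gamma nu ^ 2 * Crpower (z / 2) (- (2 * nu)) * F))%C.
Proof.
  (* The regular form of the series serves as F whether or not nu is a half-integer. *)
  exists (CPS (Fc (- nu)) ((z / 2) ^ 2)%C); split.
  { apply is_F23_neg_CPS; assumption. }
  assert (H : noninteger nu) by exact hnuZ; pose proof (noninteger_opp nu H) as H'.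
  pose proof (noninteger_neq0 nu H) as H0.
  pose proof (Gamma_neq0 nu (or_intror H)) as HG.
  pose proof (Gamma_neq0 (- nu) (or_intror H')) as HG'.
  pose proof (sin_PI_neq0 nu H) as Hs.
  apply is_derive_of_Cderive.
  assert (Ds : is_derive (fun y => / sin (PI * y)) nu
     (- (PI * cos (PI * nu)) / sin (PI * nu) ^ 2)).
  { auto_derive; [exact Hs|field; exact Hs]. }
  apply is_Cderive_ext_loc with
    (fun y => RtoC (PI / 2) * ((BesselI (- y) z - BesselI y z) * RtoC (/ sin (PI * y))))%C.
  { destruct (noninteger_locally nu H) as (d & B & [Hd _] & _ & Hn).
    exists (mkposreal d Hd); intros y Hy; unfold BesselK.
    assert (Hy' : noninteger y) by (rewrite <- (Rplus_minus nu y); apply Hn, Hy).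
    rewrite RtoC_inv by (apply sin_PI_neq0, Hy'). rewrite RtoC_div by lra. reflexivity. }
  evar_last.
  - apply is_Cderive_mult; [apply is_Cderive_RtoC, (is_derive_const (V := R_NormedModule))|].
    apply is_Cderive_mult; [apply is_Cderive_minus|apply is_Cderive_RtoC, Ds].
    + apply (is_Cderive_opp_arg (fun y => BesselI y z)), is_Cderive_BesselI, H'.
    + apply is_Cderive_BesselI, H.
  - rewrite Ropp_involutive, Gc_opp, digamma_reflection by exact H.
    rewrite F34_CPS by exact H.
    rewrite F23_CPS; [|exact H|left; lra|left; lra].
    rewrite (BesselI_CPS nu) by exact H; rewrite (BesselI_CPS (- nu)) by exact H'.
    rewrite !Gamma_plus1 by (right; assumption).
    pose proof (Gamma_reflection nu H) as ER.
    replace (- (2 * nu)) with (- nu + - nu) by ring.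
    replace (2 * nu) with (nu + nu) by ring.
    rewrite !Crpower_add.
    assert (EP : (Crpower (z / 2) nu * Crpower (z / 2) (- nu) = 1)%C)
      by (rewrite <- Crpower_add, Rplus_opp_r; apply Crpower_0).
    set (p := Crpower (z / 2) nu) in *; set (q := Crpower (z / 2) (- nu)) in *.
    assert (Hp : p <> RtoC 0).
    { intros E; rewrite E, Cmult_0_l in EP; injection EP; lra. }
    (* The relation p q = 1 is invisible to [field], so both powers are expressed through p. *)
    replace q with (/ p)%C.
    2:{ transitivity (/ p * (p * q))%C; [rewrite EP; ring|field; exact Hp]. }
    set (t := ((z / 2) ^ 2)%C).
    set (U := CPS (bc nu) t); set (V := CPS (bc (- nu)) t); set (G := CPS (Gc nu) t).
    set (F1 := CPS (Fc nu) t); set (F2 := CPS (Fc (- nu)) t).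
    set (s := sin (PI * nu)) in *; set (c := cos (PI * nu)).
    set (g := Gamma nu) in *; set (g' := Gamma (- nu)) in *.
    unfold csc, cot; fold s c.
    (* The terms with F carry 1/Gamma and csc on one side and squared gamma values on the other;
       once Gamma(-nu) is eliminated by reflection, the goal is a rational identity. *)
    assert (Eg : g' = - PI / (g * nu * s)).
    { rewrite <- ER; field; tauto. }
    rewrite Eg; clearbody p q t U V G F1 F2 s c g g'; clear - H0 HG Hs Hp.
    pose proof PI_RGT_0 as HPI.
    assert (HPI' : PI <> 0) by lra.
    unfold Rdiv.
    rewrite ?Rinv_mult, ?Rinv_opp, ?Rinv_inv, ?RtoC_plus, ?RtoC_mult, ?RtoC_opp, ?RtoC_pow.
    rewrite ?RtoC_inv by (try apply pow_nonzero; assumption || lra).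
    rewrite ?RtoC_mult, ?RtoC_opp, ?RtoC_pow.
    change (RtoC zero) with (RtoC 0); unfold Cpow.
    field.
    repeat split; try apply RtoC_neq0; assumption.
Qed.
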